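(* Let $\mathcal H$ be a Hilbert space and let $G$ be a minimally almost periodic topological subgroup of the unitary group $U(\mathcal H)$ equipped with the uniform operator (operator norm) topology. If $G$ is amenable, then $G$ does not have property $(T)$.
   Context: ''Topological subgroup'' means a subgroup with the induced topology. A topological group $G$ is minimally almost periodic if it has no non-trivial continuous finite-dimensional unitary representations. $G$ is amenable if every continuous action of $G$ on a (non-empty) compact Hausdorff space admits an invariant regular Borel probability measure. A strongly continuous unitary representation $\pi$ of $G$ has almost invariant vectors if for every $\varepsilon>0$ and every compact $K\subseteq G$ there is a unit vector $\xi$ with $\|\xi-\pi_g\xi\|<\varepsilon$ for all $g\in K$. $G$ has property $(T)$ if every strongly continuous unitary representation of $G$ having almost invariant vectors has an invariant unit vector.
   Formalization: The group G is assumed non-trivial; for G = {1} the statement as written fails, since the trivial group is minimally almost periodic, amenable and has property (T). *)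

(* Defs.v *)
From HB Require Import structures.
From mathcomp Require Import all_boot all_order all_algebra.
From mathcomp Require Import complex.
From mathcomp Require Import all_classical all_reals all_analysis.

Set Implicit Arguments.
Unset Strict Implicit.
Unset Printing Implicit Defensive.

Import Order.TTheory GRing.Theory Num.Theory.
Import numFieldNormedType.Exports.

Local Open Scope classical_set_scope.
Local Open Scope complex_scope.
Local Open Scope ring_scope.

(* The norm of a normed module over R[i] takes its values in R[i]; hnorm below
   is the same norm with values in R. *)
HB.mixin Record isHilbert (R : realType) H of CompleteNormedModule R[i] H := {
  inner : {dot H for Num.conj};
  normr_inner : forall x : H, `|x| ^+ 2 = inner x x
}.

#[short(type="hilbertType")]
HB.structure Definition Hilbert (R : realType) :=
  {H of isHilbert R H & CompleteNormedModule R[i] H}.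

Definition hnorm (R : realType) (H : hilbertType R) (x : H) : R :=
  complex.Re `|x|.

Definition opnorm (R : realType) (H : hilbertType R) (f : H -> H) : R :=
  sup [set hnorm (f x) | x in [set x | hnorm x <= 1]].

Definition is_unitary (R : realType) (H : hilbertType R) (f : H -> H) :=
  [/\ linear f, forall x y, inner (f x) (f y) = inner x y
    & forall y, exists x, f x = y].

Record unitary (R : realType) (H : hilbertType R) := Unitary {
  unitary_fun :> H -> H;
  unitaryP : is_unitary unitary_fun
}.

HB.mixin Record isTopologicalGroup G of Topological G & Group G := {
  mulg_continuous : continuous (fun p : G * G => (p.1 * p.2)%g);
  invg_continuous : continuous (fun g : G => (g^-1)%g)
}.

#[short(type="topologicalGroupType")]
HB.structure Definition TopologicalGroup :=
  {G of isTopologicalGroup G & Topological G & Group G}.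

Section hnorm_theory.
Context (R : realType) (H : hilbertType R).
Implicit Types x y : H.

Lemma hnormE x : `|x| = (hnorm x)%:C.
Proof. by rewrite /hnorm RRe_real ?normr_real. Qed.

Lemma hnorm_le1 x : (hnorm x <= 1) = (`|x| <= 1).
Proof. by rewrite -lecR -hnormE. Qed.

Lemma hnorm_ge0 x : 0 <= hnorm x.
Proof. by rewrite -lecR -hnormE rmorph0 normr_ge0. Qed.

Lemma hnorm0 : hnorm (0 : H) = 0.
Proof. by rewrite /hnorm normr0. Qed.

Lemma hnorm_eq0 x : hnorm x = 0 -> x = 0.
Proof. by move=> x0; apply/normr0_eq0; rewrite hnormE x0 rmorph0. Qed.

Lemma hnormN x : hnorm (- x) = hnorm x.
Proof. by rewrite /hnorm normrN. Qed.

Lemma hnormB x y : hnorm (x - y) = hnorm (y - x).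
Proof. by rewrite /hnorm distrC. Qed.

Lemma hnormD x y : hnorm (x + y) <= hnorm x + hnorm y.
Proof. by rewrite -lecR rmorphD/= -!hnormE ler_normD. Qed.

Lemma hnormZ (a : R) x : hnorm (a%:C *: x) = `|a| * hnorm x.
Proof.
apply: complexI; rewrite -hnormE normrZ rmorphM/= -hnormE.
by rewrite normc_def/= expr0n addr0 sqrtr_sqr.
Qed.

End hnorm_theory.

Section unitary_theory.
Context (R : realType) (H : hilbertType R).
Implicit Types (u v w : unitary H) (x y : H).

Lemma unitary_eq u v : u =1 v -> u = v.
Proof.
case: u v => [f Uf] [g Ug] /= /funext fg.
by rewrite fg in Uf *; rewrite (Prop_irrelevance Uf Ug).
Qed.

HB.instance Definition _ u :=
  GRing.isLinear.Build R[i] H H _ (unitary_fun u) (let: And3 l _ _ := unitaryP u in l).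

Lemma unitary_inner u x y : inner (u x) (u y) = inner x y.
Proof. by case: (unitaryP u). Qed.

Lemma unitary_norm u x : hnorm (u x) = hnorm x.
Proof.
congr complex.Re; apply: (@pexpIrn _ 2) => //; rewrite ?nnegrE//.
by rewrite !normr_inner unitary_inner.
Qed.

Lemma unitary_inj u : injective u.
Proof.
move=> x y uxy; apply/subr0_eq/hnorm_eq0.
by rewrite -(unitary_norm u) linearB/= uxy subrr hnorm0.
Qed.

Definition unitary_inv_fun u y : H :=
  projT1 (cid (let: And3 _ _ s := unitaryP u in s y)).

Lemma unitary_invK u : cancel (unitary_inv_fun u) u.
Proof. by move=> y; rewrite /unitary_inv_fun; case: cid. Qed.

Lemma unitaryK u : cancel u (unitary_inv_fun u).
Proof. by move=> x; apply: (@unitary_inj u); rewrite unitary_invK. Qed.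

Lemma unitary_one_subproof : is_unitary (@id H).
Proof. by split => // y; exists y. Qed.

Lemma unitary_mul_subproof u v : is_unitary (u \o v).
Proof.
split=> [a x y|x y|y] /=; first by rewrite !linearP.
  by rewrite !unitary_inner.
by exists (unitary_inv_fun v (unitary_inv_fun u y)); rewrite !unitary_invK.
Qed.

Lemma unitary_inv_subproof u : is_unitary (unitary_inv_fun u).
Proof.
split=> [a x y|x y|y]; last by exists (u y); rewrite unitaryK.
  by apply: (@unitary_inj u); rewrite linearP/= !unitary_invK.
by rewrite -(unitary_inner u) !unitary_invK.
Qed.

Definition unitary_one := Unitary unitary_one_subproof.
Definition unitary_mul u v := Unitary (unitary_mul_subproof u v).
Definition unitary_inv u := Unitary (unitary_inv_subproof u).

HB.instance Definition _ := gen_eqMixin (unitary H).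
HB.instance Definition _ := gen_choiceMixin (unitary H).

Lemma unitary_mulA : associative unitary_mul.
Proof. by move=> u v w; exact: unitary_eq. Qed.
Lemma unitary_mul1 : left_id unitary_one unitary_mul.
Proof. by move=> u; exact: unitary_eq. Qed.
Lemma unitary_mulr1 : right_id unitary_one unitary_mul.
Proof. by move=> u; exact: unitary_eq. Qed.
Lemma unitary_mulV : left_inverse unitary_one unitary_inv unitary_mul.
Proof. by move=> u; apply: unitary_eq => x /=; rewrite unitaryK. Qed.
Lemma unitary_mulrV : right_inverse unitary_one unitary_inv unitary_mul.
Proof. by move=> u; apply: unitary_eq => x /=; rewrite unitary_invK. Qed.

HB.instance Definition _ := isGroup.Build (unitary H)
  unitary_mulA unitary_mul1 unitary_mulr1 unitary_mulV unitary_mulrV.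

Lemma unitaryM u v x : (u * v)%g x = u (v x). Proof. by []. Qed.
Lemma unitary1 x : (1%g : unitary H) x = x. Proof. by []. Qed.
Lemma unitaryVK u x : u ((u^-1)%g x) = x. Proof. exact: unitary_invK. Qed.
Lemma unitaryKV u x : (u^-1)%g (u x) = x. Proof. exact: unitaryK. Qed.

Definition unitary_dist u v : R := opnorm (fun x => u x - v x).

Lemma unitary_dist_has_sup u v :
  has_sup [set hnorm (u x - v x) | x in [set x | hnorm x <= 1]].
Proof.
split; first by exists (hnorm (u 0 - v 0)), 0 => //=; rewrite hnorm0.
exists (1 + 1) => _ [x /= x1 <-]; apply: le_trans (hnormD _ _) _.
by rewrite hnormN !unitary_norm lerD.
Qed.

Lemma unitary_dist_le u v (e : R) :
  (forall x, hnorm x <= 1 -> hnorm (u x - v x) <= e) -> unitary_dist u v <= e.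
Proof.
move=> uve; apply: ge_sup; first by case: (unitary_dist_has_sup u v).
by move=> _ [x /= x1 <-]; exact: uve.
Qed.

Lemma unitary_dist_ub u v x : hnorm x <= 1 ->
  hnorm (u x - v x) <= unitary_dist u v.
Proof.
by move=> x1; apply: sup_upper_bound; [exact: unitary_dist_has_sup|exists x].
Qed.

Lemma unitary_distxx u : unitary_dist u u = 0.
Proof.
apply/eqP; rewrite eq_le; apply/andP; split.
  by apply: unitary_dist_le => x _; rewrite subrr hnorm0.
have := @unitary_dist_ub u u 0; rewrite subrr hnorm0; exact.
Qed.

Lemma unitary_dist_eq0 u v : unitary_dist u v = 0 -> u = v.
Proof.
move=> uv0; apply: unitary_eq => x; apply/subr0_eq/hnorm_eq0.
have [->|x0] := eqVneq x 0; first by rewrite (linear0 u) (linear0 v) subrr hnorm0.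
have nx0 : hnorm x != 0 by apply: contra_neq x0; exact: hnorm_eq0.
have := @unitary_dist_ub u v (((hnorm x)^-1)%:C *: x).
rewrite uv0 (linearZ_LR u) (linearZ_LR v)/= -scalerBr !hnormZ ger0_norm ?invr_ge0 ?hnorm_ge0//.
rewrite mulVf// => /(_ (lexx _)) h; apply/eqP; rewrite eq_le hnorm_ge0 andbT.
by rewrite -(@pmulr_rle0 _ ((hnorm x)^-1))// invr_gt0 lt_neqAle eq_sym nx0
  hnorm_ge0.
Qed.

Lemma unitary_dist_sym u v : unitary_dist u v = unitary_dist v u.
Proof.
by congr sup; apply: eq_imagel => x _; rewrite hnormB.
Qed.

Lemma unitary_dist_triangle v u w :
  unitary_dist u w <= unitary_dist u v + unitary_dist v w.
Proof.
apply: unitary_dist_le => x x1; rewrite -(subrKA (v x)).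
by rewrite (le_trans (hnormD _ _))// lerD// unitary_dist_ub.
Qed.

HB.instance Definition _ := isMetric.Build R (unitary H)
  unitary_distxx unitary_dist_eq0 unitary_dist_sym unitary_dist_triangle.

Lemma unitary_ballE u (e : R) : ball u e = [set v | unitary_dist u v < e].
Proof. by []. Qed.

Lemma unitary_dist_mul u u' v v' :
  unitary_dist (u * v)%g (u' * v')%g <= unitary_dist u u' + unitary_dist v v'.
Proof.
apply: unitary_dist_le => x x1; rewrite !unitaryM.
rewrite -(subrKA (u (v' x))) -linearB/= (le_trans (hnormD _ _))//.
by rewrite unitary_norm addrC lerD// unitary_dist_ub// unitary_norm.
Qed.

Lemma unitary_dist_inv u v :
  unitary_dist (u^-1)%g (v^-1)%g <= unitary_dist u v.
Proof.
apply: unitary_dist_le => x x1; rewrite -(unitary_norm u) linearB/= unitaryVK.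
rewrite -{1}(unitaryVK v x) hnormB unitary_dist_ub//.
by rewrite -(unitary_norm v) unitaryVK.
Qed.

Lemma unitary_mul_continuous :
  continuous (fun p : unitary H * unitary H => (p.1 * p.2)%g).
Proof.
move=> [u v]; apply/cvg_ballP => e e0; have e20 : 0 < e / 2 by rewrite divr_gt0.
exists (ball u (e / 2), ball v (e / 2)).
  by split; exact: nbhsx_ballx.
move=> [u' v'] [/= uu' vv']; rewrite unitary_ballE/=.
by rewrite (le_lt_trans (unitary_dist_mul _ _ _ _))// (splitr e) ltrD.
Qed.

Lemma unitary_inv_continuous : continuous (fun u : unitary H => (u^-1)%g).
Proof.
move=> u; apply/(cvg_ballP (FF := nbhs_filter u)) => e e0; near=> v.
rewrite unitary_ballE/= (le_lt_trans (unitary_dist_inv _ _))//.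
by near: v; exact: (nbhsx_ballx u).
Unshelve. all: by end_near. Qed.

HB.instance Definition _ := isTopologicalGroup.Build (unitary H)
  unitary_mul_continuous unitary_inv_continuous.

End unitary_theory.

Section topological_subgroup.
Context (gT : topologicalGroupType) (G : groupClosed gT).

(* [groupClosed gT] is the type of subsets of gT containing 1 and closed under
   product and inverse. *)
Definition subgroup := {x : gT | x \in G}.

HB.instance Definition _ := [isSub of subgroup for sval].
HB.instance Definition _ := [Choice of subgroup by <:].

Lemma subgroup_closed : group_closed (G : {pred gT}).
Proof. by split; [exact: gpred1 | move=> x y; exact: gpredF]. Qed.

HB.instance Definition _ :=
  SubChoice_isSubGroup.Build gT (fun x => x \in G) subgroup subgroup_closed.

HB.instance Definition _ :=
  Topological.copy subgroup (initial_topology (val : subgroup -> gT)).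

Lemma subgroup_val_continuous : continuous (val : subgroup -> gT).
Proof. exact: initial_continuous. Qed.

Lemma subgroup_mul_continuous :
  continuous (fun p : subgroup * subgroup => (p.1 * p.2)%g).
Proof.
apply: continuous_comp_initial => -[x y].
rewrite (_ : _ \o _ = (fun p : gT * gT => (p.1 * p.2)%g) \o
  (fun p : subgroup * subgroup => (val p.1, val p.2))); last first.
  by apply/funext.
apply: continuous_comp; last exact: mulg_continuous.
have c1 : continuous (fun p : subgroup * subgroup => val p.1 : gT).
  move=> p; apply: continuous_comp; first exact: cvg_fst.
  exact: subgroup_val_continuous.
have c2 : continuous (fun p : subgroup * subgroup => val p.2 : gT).
  move=> p; apply: continuous_comp; first exact: cvg_snd.
  exact: subgroup_val_continuous.
exact: (cvg_pair (c1 (x, y)) (c2 (x, y))).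
Qed.

Lemma subgroup_inv_continuous : continuous (fun x : subgroup => (x^-1)%g).
Proof.
apply: continuous_comp_initial => x.
rewrite (_ : _ \o _ = (fun x : gT => (x^-1)%g) \o val); last by apply/funext.
apply: continuous_comp; first exact: subgroup_val_continuous.
exact: invg_continuous.
Qed.

HB.instance Definition _ := isTopologicalGroup.Build subgroup
  subgroup_mul_continuous subgroup_inv_continuous.

End topological_subgroup.

Section group_properties.
Context (R : realType) (G : topologicalGroupType).

Definition strongly_continuous (H : hilbertType R) (pi : G -> unitary H) :=
  forall xi : H, continuous (fun g => pi g xi).

Definition finite_dimensional (H : hilbertType R) :=
  exists (n : nat) (e : 'I_n -> H),
    forall x, exists c : 'I_n -> R[i], x = \sum_(i < n) c i *: e i.

(* In finite dimension, strong and norm continuity of a representation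
   coincide. *)
Definition minimally_almost_periodic :=
  forall (H : hilbertType R) (pi : Multiplicative.type G (unitary H)),
    finite_dimensional H -> strongly_continuous pi ->
    forall g, pi g = 1%g.

Definition almost_invariant_vectors (H : hilbertType R)
    (pi : G -> unitary H) :=
  forall (e : R) (K : set G), 0 < e -> compact K ->
    exists2 xi : H, `|xi| = 1 & forall g, K g -> `|xi - pi g xi| < e%:C.

Definition property_T :=
  forall (H : hilbertType R) (pi : Multiplicative.type G (unitary H)),
    strongly_continuous pi -> almost_invariant_vectors pi ->
    exists2 xi : H, `|xi| = 1 & forall g, pi g xi = xi.

(* Compact sets are Borel in the Hausdorff spaces considered below. *)
Definition regular_borel (X : ptopologicalType)
    (mu : set (g_sigma_algebraType (@open X)) -> \bar R) :=
  forall A : set (g_sigma_algebraType (@open X)), measurable A ->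
    mu A = ereal_inf [set mu U | U in [set U : set X | open U /\ A `<=` U]] /\
    mu A = ereal_sup [set mu K | K in [set K : set X | compact K /\ K `<=` A]].

Definition continuous_action (X : topologicalType) (act : G -> X -> X) :=
  [/\ forall x, act 1%g x = x,
      forall g h x, act (g * h)%g x = act g (act h x)
    & continuous (fun p : G * X => act p.1 p.2)].

(* A ptopologicalType has a distinguished point, hence is non-empty. *)
Definition amenable :=
  forall (X : ptopologicalType) (act : G -> X -> X),
    compact [set: X] -> hausdorff_space X -> continuous_action act ->
    exists mu : probability (g_sigma_algebraType (@open X)) R,
      regular_borel mu /\
      forall g (A : set (g_sigma_algebraType (@open X))), measurable A ->
        mu (act g @^-1` A) = mu A.

End group_properties.

(* Main.v *)
Require Import Defs.
From HB Require Import structures.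
From mathcomp Require Import all_boot all_order all_algebra.
From mathcomp Require Import complex.
From mathcomp Require Import all_classical all_reals all_analysis.
From mathcomp Require Import measurable_realfun.
From mathcomp Require Import ring lra.

Set Implicit Arguments.
Unset Strict Implicit.
Unset Printing Implicit Defensive.

Import Order.TTheory GRing.Theory Num.Theory.
Import numFieldNormedType.Exports.

Local Open Scope classical_set_scope.
Local Open Scope complex_scope.
Local Open Scope ring_scope.

(* Amenability yields finitely supported probabilities on G that are almost invariant on bounded
   Lipschitz functions (Reiter's condition). This comes from an invariant measure on a compact space
   of Lipschitz functions on G, after a minimax and a compactness argument. Applied to the orbit of
   a unit vector, it gives almost invariant density operators on H; here it matters that G carries
   the operator norm topology. By the Powers-Stormer inequality their square roots are almost
   invariant unit vectors for the conjugation representation on Hilbert-Schmidt operators. Property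
   (T) then provides an invariant Hilbert-Schmidt operator, and a top eigenspace of its hermitian
   part (after multiplication by a scalar) is a finite dimensional invariant subspace, on which G
   acts trivially by minimal almost periodicity. Carried out in the orthogonal complement of the
   G-fixed vectors, which is not 0 when G is not trivial, this is a contradiction. *)

(** The functions to which amenability is applied are [h -> <S rho(h) x0, rho(h) x0>], with [x0] a
    unit vector and [S] a self-adjoint contraction. The orbit distance [|h x0 - h' x0|] controls
    them but is invariant only under left multiplication. The argument lets G act by right
    translation on a compact space of Lipschitz functions: preserving the Lipschitz bound asks for
    [d(h k, h' k) <= d(h, h')], and joint continuity of the action for [d(h k, h k') <= d(k, k')].
    The operator norm distance satisfies both and is continuous on G. Almost invariance must be
    uniform over all these functions, because the [S] to be tested is the sign of a difference of
    operators that is known only after the weights have been chosen. Fixed vectors are split off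
    because a fixed vector [y] gives the invariant operator [y y^*], so that an invariant
    Hilbert-Schmidt operator alone would contradict nothing. The trivial group is minimally almost
    periodic, amenable and has property (T), whence the element other than 1 in the theorem. *)

(** The scalar core of Cauchy-Schwarz, isolated because it serves three different forms below. The
    hypothesis is the expansion of a nonnegative hermitian form at [x + a y]. *)
Lemma discriminant_le (C : numClosedFieldType) (A B z : C) : 0 <= A -> 0 <= B ->
  (forall a : C, 0 <= A + a * z^* + a^* * z + `|a| ^+ 2 * B) ->
  `|z| ^+ 2 <= A * B.
Proof.
move=> A0 B0 h; have [B_eq0|Bn0] := eqVneq B 0.
  have [->|zn0] := eqVneq z 0; first by rewrite normr0 expr0n/= mulr_ge0.
  have nz : 0 < `|z| ^+ 2 by rewrite exprn_gt0// normr_gt0.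
  (* Chosen so that the hypothesis at [- t z], which is affine in [t] when [B = 0], reads
     [0 <= -1]. *)
  set t := (A + 1) / (2 * `|z| ^+ 2).
  have t0 : 0 <= t.
    by rewrite divr_ge0// ?addr_ge0// ?mulr_ge0// ltW.
  have := h (- t * z); rewrite B_eq0 mulr0 addr0 rmorphM rmorphN/= (geC0_conj t0).
  have -> : A + - t * z * z^* + - t * z^* * z = A - 2 * t * (z * z^*) by ring.
  rewrite -normCK /t (_ : _ - _ = -1); last first.
    field; rewrite ?normr_eq0 ?zn0 ?pnatr_eq0 /=. by [].
  by rewrite ler0N1.
have Bgt0 : 0 < B by rewrite lt_neqAle eq_sym Bn0.
have zBC : (z / B)^* = z^* / B by rewrite rmorphM/= fmorphV/= (geC0_conj B0).
(* The expression is minimal at [a = - z / B]. *)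
have := h (- (z / B)); rewrite rmorphN/= zBC normrN.
rewrite normrM normfV (ger0_norm B0).
have -> : A + - (z / B) * z^* + - (z^* / B) * z = A - 2 * (z * z^*) / B by ring.
rewrite -normCK (_ : _ + _ = A - `|z| ^+ 2 / B); last by field.
by rewrite subr_ge0 ler_pdivrMr.
Qed.

(** * Hilbert spaces from complete inner products *)

(** Completeness is asked for sequences and squared norms, which is what the concrete spaces below
    can check. The norm, the topology and completeness for Cauchy filters are derived from it. *)
Record innerProductSpace (R : realType) := InnerProductSpace {
  ips_sort :> lmodType R[i];
  ips_form : ips_sort -> ips_sort -> R[i];
  ips_linear : forall z, scalar (ips_form ^~ z);
  ips_conj : forall x y, ips_form x y = (ips_form y x)^*;
  ips_gt0 : forall x, x != 0 -> 0 < ips_form x x;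
  ips_complete : forall u : nat -> ips_sort,
    (forall e : R, 0 < e -> exists N, forall m n, (N <= m)%N -> (N <= n)%N ->
      ips_form (u m - u n) (u m - u n) <= e%:C) ->
    exists x, forall e : R, 0 < e -> exists N, forall n, (N <= n)%N ->
      ips_form (u n - x) (u n - x) <= e%:C }.

Definition ipsT (R : realType) (P : innerProductSpace R) : Type := P.

Section innerProductSpace_theory.
Context (R : realType) (P : innerProductSpace R).
Implicit Types (x y z : P) (a : R[i]).
Local Notation f := (@ips_form R P).

HB.instance Definition _ := GRing.Lmodule.on (ipsT P).

Lemma ips_linearr z a x y : f z (a *: x + y) = a^* * f z x + f z y.
Proof.
by rewrite ips_conj ips_linear rmorphD rmorphM/= -!ips_conj.
Qed.

Lemma ips_form_bilinear :
  bilinear_for *%R (Num.conj \; *%R) (f : ipsT P -> ipsT P -> R[i]).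
Proof. by split=> z a x y /=; rewrite ?ips_linear ?ips_linearr. Qed.

HB.instance Definition _ := @bilinear_isBilinear.Build R[i] (ipsT P) (ipsT P)
  R[i] *%R (Num.conj \; *%R) (f : ipsT P -> ipsT P -> R[i]) ips_form_bilinear.


Definition ips_dot : ipsT P -> ipsT P -> R[i] := f.

HB.instance Definition _ := Bilinear.on ips_dot.

Lemma ips_hermitian x y : ips_dot x y = (-1) ^+ false * (ips_dot y x)^*.
Proof. by rewrite expr0 mul1r; exact: ips_conj. Qed.

HB.instance Definition _ := @isHermitianSesquilinear.Build R[i] (ipsT P) false
  Num.conj ips_dot ips_hermitian.
HB.instance Definition _ := @isDotProduct.Build R[i] (ipsT P) ips_dot
  (@ips_gt0 R P).

Lemma ips_ge0 x : 0 <= f x x.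
Proof.
have [->|/ips_gt0/ltW//] := eqVneq x 0.
by rewrite (_ : f 0 0 = 0)//; exact: (linear0l ips_dot).
Qed.

Lemma ips_cauchy_schwarz x y : `|f x y| ^+ 2 <= f x x * f y y.
Proof.
apply: discriminant_le; rewrite ?ips_ge0// => a.
have := ips_ge0 (a *: y + x); rewrite ips_linear !ips_linearr -(ips_conj y x).
congr (0 <= _); rewrite normCK; ring.
Qed.

Definition ips_norm (x : ipsT P) : R[i] := sqrtC (f x x).

Lemma ips_normD x y : ips_norm (x + y) <= ips_norm x + ips_norm y.
Proof.
rewrite -(@ler_pXn2r _ 2) ?nnegrE ?addr_ge0 ?sqrtC_ge0 ?ips_ge0//.
rewrite sqrtCK sqrrD !sqrtCK -[x in f (x + _)]scale1r -[x in f _ (x + _)]scale1r.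
rewrite ips_linear !ips_linearr conjC1 !mul1r.
suff : f x y + f y x <= sqrtC (f x x) * sqrtC (f y y) *+ 2.
  move=> h; rewrite [leLHS](_ : _ = f x x + (f x y + f y x) + f y y); last by ring.
  by rewrite lerD2r lerD2l.
rewrite [f y x]ips_conj; set z := f x y.
have : `|z| <= sqrtC (f x x) * sqrtC (f y y).
  rewrite -(@ler_pXn2r _ 2) ?nnegrE ?mulr_ge0 ?sqrtC_ge0 ?ips_ge0//.
  by rewrite exprMn !sqrtCK ips_cauchy_schwarz.
move=> /(ler_wMn2r 2); apply: le_trans.
rewrite (_ : z + z^* = (complex.Re z)%:C *+ 2); last first.
  by rewrite ReJ_add -[RHS]mulr_natr divfK ?pnatr_eq0.
rewrite lerMn2r/=; apply: le_trans (normc_ge_Re z).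
by rewrite lecR ler_norm.
Qed.

Lemma ips_normZ a (x : ipsT P) : ips_norm (a *: x) = `|a| * ips_norm x.
Proof.
rewrite /ips_norm -[a *: x]addr0 ips_linear ips_linearr.
rewrite (_ : f x 0 = 0); last exact: (linear0r ips_dot).
rewrite (_ : f 0 _ = 0); last exact: (linear0l ips_dot).
rewrite !addr0 mulrA -normCK sqrtCM ?nnegrE ?exprn_ge0 ?ips_ge0//.
by rewrite exprCK.
Qed.

Lemma ips_norm_eq0 (x : ipsT P) : ips_norm x = 0 -> x = 0.
Proof.
move=> /eqP; rewrite sqrtC_eq0; apply: contraPeq => /ips_gt0 h.
by move=> /eqP h0; rewrite h0 ltxx in h.
Qed.

HB.instance Definition _ := @Lmodule_isNormed.Build R[i] (ipsT P) ips_norm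
  ips_normD ips_normZ ips_norm_eq0.

Lemma ips_normE (x : ipsT P) : `|x| ^+ 2 = f x x.
Proof. exact: sqrtCK. Qed.

(** Balls of radius [1/(n+1)] that belong to the filter have centres [u n] forming a Cauchy
    sequence, since any two of these balls meet. The limit of the centres is the limit of the
    filter. *)
Lemma ips_cauchy_cvg (F : set_system (ipsT P)) :
  ProperFilter F -> cauchy F -> cvg F.
Proof.
move=> FF Fc; pose r n : R := n.+1%:R^-1.
have r0 n : 0 < r n by rewrite invr_gt0 ltr0n.
have small (e : R) : 0 < e -> exists N, forall n, (N <= n)%N -> r n <= e.
  move=> /ltr_add_invr[N]; rewrite add0r => hN; exists N => n Nn.
  by rewrite (le_trans _ (ltW hN))// lef_pV2 ?posrE ?ltr0n// ler_nat.
have Fball n : exists x : ipsT P, F (ball x (r n)%:C).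
  by move/cauchyP : Fc => /(_ (r n)%:C); apply; rewrite ltcR.
pose u n := projT1 (cid (Fball n)).
have Fu n : F (ball (u n) (r n)%:C) by rewrite /u; case: cid.
have uu m n : `|u m - u n| <= (r m + r n)%:C.
  have [z [zm zn]] := filter_ex (filterI (Fu m) (Fu n)).
  move: zm zn; rewrite -!ball_normE /= => /ltW zm /ltW; rewrite distrC => zn.
  by rewrite -(subrKA z) (le_trans (ler_normD _ _))// rmorphD lerD.
have [] := @ips_complete R P u.
  move=> e e0; have s0 : 0 < Num.sqrt e / 2 by rewrite divr_gt0 ?sqrtr_gt0.
  have [N hN] := small _ s0; exists N => m n /hN mN /hN nN.
  rewrite -ips_normE -(sqr_sqrtr (ltW e0)) rmorphXn/= ler_pXn2r ?nnegrE ?normr_ge0//.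
    by rewrite (le_trans (uu m n))// lecR; lra.
  by rewrite lecR sqrtr_ge0.
move=> x ux; apply/cvg_ex; exists x; apply/(@cvg_ballP R[i]) => e e0.
have er : e = (complex.Re e)%:C by rewrite RRe_real// gtr0_real.
have {}e0 : 0 < complex.Re e by rewrite er ltcR in e0.
set d := complex.Re e in er e0; have d0 : 0 < d / 2 by rewrite divr_gt0.
have [N1 h1] := ux _ (exprn_gt0 2 d0); have [N2 h2] := small _ d0.
pose n := maxn N1 N2; rewrite er.
have un : `|u n - x| <= (d / 2)%:C.
  rewrite -(@ler_pXn2r _ 2) ?nnegrE ?normr_ge0 ?lecR ?(ltW d0)// ips_normE -rmorphXn.
  by apply: h1; rewrite leq_maxl.
apply: filterS (Fu n) => y; rewrite -!ball_normE /= => uy.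
rewrite -(subrKA (u n)) (le_lt_trans (ler_normD _ _))// distrC (splitr d) rmorphD.
rewrite ler_ltD// (lt_le_trans uy)// lecR; apply: h2.
by rewrite leq_maxr.
Qed.

HB.instance Definition _ := Uniform_isComplete.Build (ipsT P) ips_cauchy_cvg.

HB.instance Definition _ := @isHilbert.Build R (ipsT P) ips_dot ips_normE.

End innerProductSpace_theory.

(** * Orthonormal families and finite rank operators *)

Section normsq.
Context (R : realType).
Implicit Types (z w : R[i]).

Definition normsq z : R := complex.Re z ^+ 2 + complex.Im z ^+ 2.

Lemma normsqE z : (normsq z)%:C = `|z| ^+ 2.
Proof. exact: add_Re2_Im2. Qed.

Lemma normsq_conj z : (normsq z)%:C = z * z^*.
Proof. by rewrite normsqE normCK. Qed.

Lemma normsq_ge0 z : 0 <= normsq z.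
Proof. by rewrite addr_ge0 ?sqr_ge0. Qed.

Lemma normsqM z w : normsq (z * w) = normsq z * normsq w.
Proof. by apply: complexI; rewrite rmorphM/= !normsqE normrM exprMn. Qed.

Lemma normsqC z : normsq z^* = normsq z.
Proof. by apply: complexI; rewrite !normsqE norm_conjC. Qed.

Lemma normsq_real (a : R) : normsq a%:C = a ^+ 2.
Proof. by rewrite /normsq/= expr0n addr0. Qed.

Lemma Re_sqr_le z : complex.Re z ^+ 2 <= normsq z.
Proof. by rewrite lerDl sqr_ge0. Qed.

End normsq.

Section hilbert_theory.
Context (R : realType) (H : hilbertType R).
Implicit Types (x y z : H) (a : R[i]).

Lemma innerC x y : inner x y = (inner y x)^*.
Proof. by rewrite [LHS](hermC inner) expr0 mul1r. Qed.

Lemma innerDl x y z : inner (x + y) z = inner x z + inner y z.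
Proof. exact: linearDl. Qed.
Lemma innerDr x y z : inner z (x + y) = inner z x + inner z y.
Proof. exact: linearDr. Qed.
Lemma innerBl x y z : inner (x - y) z = inner x z - inner y z.
Proof. exact: linearBl. Qed.
Lemma innerBr x y z : inner z (x - y) = inner z x - inner z y.
Proof. exact: linearBr. Qed.
Lemma innerZl a x z : inner (a *: x) z = a * inner x z.
Proof. exact: linearZl_LR. Qed.
Lemma innerZr a x z : inner z (a *: x) = a^* * inner z x.
Proof. exact: linearZr_LR. Qed.
Lemma inner0l z : inner (0 : H) z = 0.
Proof. exact: linear0l. Qed.
Lemma inner_suml I (r : seq I) (F : I -> H) z :
  inner (\sum_(i <- r) F i) z = \sum_(i <- r) inner (F i) z.
Proof. exact: linear_sumlz. Qed.
Lemma inner_sumr I (r : seq I) (F : I -> H) z :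
  inner z (\sum_(i <- r) F i) = \sum_(i <- r) inner z (F i).
Proof. exact: linear_sumr. Qed.

Lemma innerxx x : inner x x = (hnorm x ^+ 2)%:C.
Proof. by rewrite -normr_inner hnormE rmorphXn. Qed.

Lemma hnormZC a x : hnorm (a *: x) = complex.Re `|a| * hnorm x.
Proof.
apply: complexI; rewrite -hnormE normrZ rmorphM/= hnormE.
by rewrite RRe_real ?normr_real.
Qed.

Lemma hnorm_sqrZ a x : hnorm (a *: x) ^+ 2 = normsq a * hnorm x ^+ 2.
Proof.
apply: complexI; rewrite [RHS]rmorphM/= -!innerxx innerZl innerZr mulrA.
by rewrite normsq_conj.
Qed.

Lemma hnorm_sqrD x y :
  hnorm (x + y) ^+ 2 = hnorm x ^+ 2 + hnorm y ^+ 2 + 2 * complex.Re (inner x y).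
Proof.
apply: complexI; rewrite -innerxx !rmorphD/=. rewrite -!innerxx innerDl !innerDr.
by rewrite rmorphM/= ReJ_add -[(inner x y)^*%C]innerC; field.
Qed.

Lemma hnorm_sqrB x y :
  hnorm (x - y) ^+ 2 = hnorm x ^+ 2 + hnorm y ^+ 2 - 2 * complex.Re (inner x y).
Proof.
rewrite hnorm_sqrD Defs.hnormN (_ : inner x (- y) = - inner x y) ?raddfN ?mulrN//.
Qed.

Lemma hnorm_parallelogram x y :
  hnorm (x + y) ^+ 2 + hnorm (x - y) ^+ 2 = 2 * (hnorm x ^+ 2 + hnorm y ^+ 2).
Proof. by rewrite hnorm_sqrD hnorm_sqrB; ring. Qed.

Lemma normsq_inner_le x y : normsq (inner x y) <= hnorm x ^+ 2 * hnorm y ^+ 2.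
Proof.
rewrite -lecR normsqE rmorphM/= -!innerxx.
apply: discriminant_le; rewrite ?innerxx ?ler0c ?sqr_ge0// => a.
rewrite -!innerxx -innerC.
rewrite [X in 0 <= X](_ : _ = inner (x + a *: y) (x + a *: y)).
  by rewrite innerxx ler0c sqr_ge0.
by rewrite innerDl !innerDr !innerZl !innerZr normCK; ring.
Qed.

Lemma Re_inner_le x y : complex.Re (inner x y) <= hnorm x * hnorm y.
Proof.
apply: le_trans (ler_norm _) _.
rewrite -(@ler_pXn2r _ 2) ?nnegrE ?mulr_ge0 ?hnorm_ge0// real_normK ?num_real//.
by rewrite exprMn (le_trans (Re_sqr_le _))// normsq_inner_le.
Qed.

Definition orthonormal_family n (e : 'I_n -> H) :=
  forall i j, inner (e i) (e j) = (i == j)%:R.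

Lemma inner_orthonormal_sum n (e : 'I_n -> H) (c : 'I_n -> R[i]) j :
  orthonormal_family e -> inner (\sum_i c i *: e i) (e j) = c j.
Proof.
move=> oe; rewrite inner_suml (bigD1 j)//= innerZl oe eqxx mulr1 big1 ?addr0//.
by move=> i ij; rewrite innerZl oe (negbTE ij) mulr0.
Qed.

Lemma orthonormal_hnorm n (e : 'I_n -> H) i : orthonormal_family e -> hnorm (e i) = 1.
Proof.
move=> oe; apply/eqP; rewrite -(@eqrXn2 _ 2) ?hnorm_ge0// expr1n; apply/eqP.
by apply: complexI; rewrite -innerxx oe eqxx.
Qed.

Lemma hnorm_sqr_orthonormal n (e : 'I_n -> H) (c : 'I_n -> R[i]) :
  orthonormal_family e -> hnorm (\sum_i c i *: e i) ^+ 2 = \sum_i normsq (c i).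
Proof.
move=> oe; apply: complexI; rewrite -innerxx rmorph_sum inner_sumr; apply: eq_bigr => i _.
by rewrite innerZr inner_orthonormal_sum//= normsq_conj mulrC.
Qed.

Definition projection n (e : 'I_n -> H) x := \sum_i inner x (e i) *: e i.

Lemma inner_projection n (e : 'I_n -> H) x j : orthonormal_family e ->
  inner (x - projection e x) (e j) = 0.
Proof. by move=> oe; rewrite innerBl inner_orthonormal_sum// subrr. Qed.

Lemma bessel n (e : 'I_n -> H) x : orthonormal_family e ->
  \sum_i normsq (inner x (e i)) <= hnorm x ^+ 2.
Proof.
move=> oe; rewrite -(hnorm_sqr_orthonormal _ oe) -/(projection e x).
rewrite -[X in _ <= hnorm X ^+ 2](subrK (projection e x)) hnorm_sqrD.
rewrite [inner (x - _) _]inner_sumr big1 ?mulr0 ?addr0 ?lerDr ?sqr_ge0//.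
by move=> i _; rewrite innerZr inner_projection// mulr0.
Qed.

(** One Gram-Schmidt step, with the new vector in last position. The last clause records its
    direction, so that it can be shown to remain in a given subspace or to be orthogonal to the span
    of [e]. *)
Lemma orthonormal_extend n (e : 'I_n -> H) x : orthonormal_family e ->
  x <> projection e x ->
  exists e' : 'I_n.+1 -> H, [/\ orthonormal_family e',
    forall i, e' (lift ord_max i) = e i
    & exists a, e' ord_max = a *: (x - projection e x)].
Proof.
move=> oe /eqP; rewrite -subr_eq0; set d := x - _ => d0.
have nd0 : hnorm d != 0 by apply: contra_neq d0; exact: hnorm_eq0.
pose a : R[i] := ((hnorm d)^-1)%:C; exists (fun i => oapp e (a *: d) (unlift ord_max i)).
split => [i j|i|]; last by exists a; rewrite unlift_none.
  have aC : a^* = a by rewrite geC0_conj// ler0c invr_ge0 hnorm_ge0.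
  case: unliftP => [i' ->|->]; case: unliftP => [j' ->|->] /=.
  - by rewrite oe (inj_eq lift_inj).
  - by rewrite innerZr innerC inner_projection// conjC0 mulr0 eq_sym (negbTE (neq_lift _ _)).
  - by rewrite innerZl inner_projection// mulr0 (negbTE (neq_lift _ _)).
  - rewrite innerZl innerZr innerxx aC eqxx -!rmorphM/= -[RHS]/(1%:C).
    by congr (_%:C); field.
by rewrite liftK.
Qed.

End hilbert_theory.

Section finite_rank.
Context (R : realType) (H : hilbertType R).
Implicit Types (x y z : H) (a : R[i]).

Lemma exists_orthonormal_span (s : seq H) : exists n (e : 'I_n -> H),
  orthonormal_family e /\ forall x, x \in s -> x = projection e x.
Proof.
elim: s => [|x s [n [e [oe es]]]].
  by exists 0, (fun=> 0); split=> // -[].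
have [xe|/(orthonormal_extend oe)[e' [oe' e'e [a e'a]]]] := pselect (x = projection e x).
  by exists n, e; split=> // y; rewrite inE => /predU1P[->|/es].
exists n.+1, e'; split=> // y.
have pe' z : projection e' z =
    inner z (e' ord_max) *: e' ord_max + projection e z.
  rewrite /projection (bigD1_ord ord_max)//=; congr (_ + _).
  by apply: eq_bigr => i _; rewrite e'e.
rewrite inE => /predU1P[->|/es ys]; rewrite pe'.
  have -> : inner x (e' ord_max) *: e' ord_max = x - projection e x.
    have := oe' ord_max ord_max; rewrite eqxx e'a.
    set d := x - _; rewrite innerZl !innerZr scalerA => aa.
    have -> : inner x d = inner d d.
      rewrite {2}/d innerBl [inner (projection _ _) _]inner_suml big1 ?subr0// => i _.
      by rewrite innerZl [inner (e i) _]innerC inner_projection// conjC0 mulr0.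
    by rewrite mulrC aa scale1r.
  by rewrite subrK.
rewrite e'a innerZr (_ : inner y _ = 0) ?mulr0 ?scale0r ?add0r//.
rewrite {1}ys inner_suml big1// => i _.
by rewrite innerZl [inner (e i) _]innerC inner_projection// conjC0 mulr0.
Qed.

Lemma parseval n (e : 'I_n -> H) x y : x = projection e x ->
  inner x y = \sum_i inner x (e i) * inner (e i) y.
Proof.
by move=> {1}->; rewrite inner_suml; apply: eq_bigr => i _; rewrite innerZl.
Qed.

(** The spectral theorem [M = P^* D P] written in entries, with [P] unitary and [D] real
    diagonal. *)
Lemma hermitian_diagonalization n (M : 'M[R[i]]_n) :
  (forall p q, M p q = (M q p)^*) ->
  exists (P : 'M[R[i]]_n) (l : 'I_n -> R),
    (forall i j, \sum_p P i p * (P j p)^* = (i == j)%:R) /\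
    forall p q, M p q = \sum_i (l i)%:C * ((P i p)^* * P i q).
Proof.
move=> Mh; have Mherm : M \is hermsymmx.
  apply/is_hermitianmxP; rewrite expr0 scale1r; apply/matrixP => p q.
  by rewrite !mxE; exact: Mh.
have /mxOverP lR := hermitian_spectral_diag_real Mherm.
have /orthomx_spectralP := hermitian_normalmx Mherm.
have PU := spectral_unitarymx M; rewrite invmx_unitary//.
set P := spectralmx M in PU *; set D := spectral_diag M in lR * => ME.
exists P, (fun i => complex.Re (D ord0 i)); split.
  move=> i j; have /unitarymxP/matrixP/(_ i j) := PU; rewrite !mxE => <-.
  by apply: eq_bigr => p _; rewrite !mxE.
move=> p q; rewrite {1}ME mxE; apply: eq_bigr => i _.
rewrite mul_mx_diag !mxE RRe_real//.
by rewrite mulrCA mulrA.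
Qed.

(* Both sides are the form of the operator [\sum_k c_k z_k z_k^*], whose trace is the last sum. *)
Lemma finite_rank_diagonalization N (z : 'I_N -> H) (c : 'I_N -> R) :
  exists n (e : 'I_n -> H) (l : 'I_n -> R),
    [/\ orthonormal_family e,
      forall x y, \sum_k (c k)%:C * (inner x (z k) * inner (z k) y) =
                  \sum_i (l i)%:C * (inner x (e i) * inner (e i) y)
    & \sum_i l i = \sum_k c k * hnorm (z k) ^+ 2].
Proof.
have [n [b [ob bz]]] := exists_orthonormal_span (codom z).
(* The coefficients of the operator in an orthonormal basis [b] of the span of the [z k]; its
   diagonalization is carried back to [H] through [b]. *)
pose M := \matrix_(p < n, q < n)
  \sum_k (c k)%:C * ((inner (z k) (b p))^* * inner (z k) (b q)).
have [p q|P [l [PP MP]]] := @hermitian_diagonalization _ M.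
  rewrite !mxE rmorph_sum; apply: eq_bigr => k _ /=.
  rewrite !rmorphM/= conjCK [_^* * inner _ _]mulrC; congr (_ * _).
  by rewrite (_ : _^* = (c k)%:C)//; exact: conjc_real.
pose e i := \sum_p P i p *: b p.
have xe x i : inner x (e i) = \sum_p (P i p)^* * inner x (b p).
  by rewrite inner_sumr; apply: eq_bigr => p _; rewrite innerZr.
have ey i y : inner (e i) y = \sum_p P i p * inner (b p) y.
  by rewrite inner_suml; apply: eq_bigr => p _; rewrite innerZl.
exists n, e, l; split=> [i j|x y|]; last 1 first.
  have -> : \sum_k c k * hnorm (z k) ^+ 2 = \sum_p complex.Re (M p p).
    apply: complexI; rewrite !rmorph_sum.
    transitivity (\sum_k \sum_p (c k)%:C * ((inner (z k) (b p))^* * inner (z k) (b p))).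
      apply: eq_bigr => k _; rewrite -mulr_sumr /= rmorphM/= -innerxx; congr (_ * _).
      rewrite (parseval (z k) (bz _ (codom_f z k))); apply: eq_bigr => p _.
      by rewrite [inner (b p) _]innerC mulrC.
    rewrite exchange_big; apply: eq_bigr => p _ /=; rewrite RRe_real ?mxE//.
    apply: rpred_sum => k _; rewrite realM ?complex_real//.
    by rewrite mulrC -normCK ger0_real// exprn_ge0.
  apply: complexI; rewrite !rmorph_sum.
  transitivity (\sum_i \sum_p (l i)%:C * ((P i p)^* * P i p)).
    apply: eq_bigr => i _; rewrite -mulr_sumr.
    under eq_bigr do rewrite mulrC.
    by rewrite PP eqxx mulr1.
  rewrite exchange_big; apply: eq_bigr => p _ /=; rewrite RRe_real ?MP//.
  apply: rpred_sum => i _; rewrite realM ?complex_real//.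
  by rewrite mulrC -normCK ger0_real// exprn_ge0.
  rewrite xe -PP; apply: eq_bigr => p _; rewrite inner_orthonormal_sum//.
  by rewrite mulrC.
transitivity (\sum_p \sum_q M p q * (inner x (b p) * inner (b q) y)).
  under eq_bigr => k _.
    rewrite [inner x _]innerC (parseval x (bz _ (codom_f z k))).
    rewrite (parseval y (bz _ (codom_f z k))) rmorph_sum big_distrl/= big_distrr/=.
    under eq_bigr do rewrite big_distrr/= big_distrr/=.
    over.
  rewrite exchange_big; apply: eq_bigr => p _; rewrite exchange_big.
  apply: eq_bigr => q _; rewrite mxE big_distrl/=; apply: eq_bigr => k _.
  by rewrite rmorphM/= -[(inner (b p) x)^*]innerC; ring.
under [RHS]eq_bigr => i _.
  rewrite xe ey big_distrl/= big_distrr/=.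
  under eq_bigr do rewrite big_distrr/= big_distrr/=.
  over.
rewrite [RHS]exchange_big; apply: eq_bigr => p _; rewrite [RHS]exchange_big.
apply: eq_bigr => q _; rewrite MP big_distrl/=; apply: eq_bigr => i _; ring.
Qed.

End finite_rank.

(** * The Powers-Stormer inequality *)

Section powers_stormer.
Context (R : realType) (H : hilbertType R).
Implicit Types (x y z : H).

Lemma inner_ext x x' : (forall y, inner x y = inner x' y) -> x = x'.
Proof.
move=> h; apply/subr0_eq/hnorm_eq0; apply/eqP; rewrite -sqrf_eq0; apply/eqP.
by apply: complexI; rewrite -innerxx innerBl h subrr.
Qed.

Lemma normsq_innerC x y : normsq (inner x y) = normsq (inner y x).
Proof. by rewrite innerC normsqC. Qed.

Lemma inner_mulC x y : inner x y * inner y x = (normsq (inner x y))%:C.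
Proof. by rewrite normsq_conj -innerC. Qed.

Lemma sum_sqr_normsq m (a : 'I_m -> R) (v : 'I_m -> H) x : orthonormal_family v ->
  \sum_k a k ^+ 2 * normsq (inner (v k) x) =
  hnorm (\sum_k ((a k)%:C * inner x (v k)) *: v k) ^+ 2.
Proof.
move=> ov; rewrite hnorm_sqr_orthonormal//; apply: eq_bigr => k _.
by rewrite normsqM normsq_real normsq_innerC.
Qed.

Lemma hermitian_form_sum m (a : 'I_m -> R) (v : 'I_m -> H) x :
  \sum_k (a k)%:C * (inner x (v k) * inner (v k) x) =
  (\sum_k a k * normsq (inner (v k) x))%:C.
Proof.
rewrite rmorph_sum; apply: eq_bigr => k _ /=.
by rewrite inner_mulC rmorphM/= normsq_innerC.
Qed.

(** The form of the operator [\sum_i s_i e_i e_i^*], a self-adjoint contraction when [e] is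
    orthonormal and [|s_i| <= 1]. *)
Definition quadratic_test n (e : 'I_n -> H) (s : 'I_n -> R) x : R :=
  \sum_i s i * normsq (inner x (e i)).

(** Put [A = \sum_k a_k u_k u_k^*] and [B = \sum_k a_k v_k v_k^*]. The left side is the squared
    Hilbert-Schmidt norm of [B - A], and the right side is the trace of [S (B^2 - A^2)] for an
    explicit contraction [S], which replaces the trace norm of [B^2 - A^2]. Here [S] is the sign of
    [B - A]. On an eigenvector [e_i] of [B - A] with eigenvalue [l_i], the form of [B^2 - A^2] is
    [l_i (<B e_i, e_i> + <A e_i, e_i>)], and [|l_i|] is at most the sum in parentheses because [A]
    and [B] are nonnegative. *)
Lemma powers_stormer m (u v : 'I_m -> H) (a : 'I_m -> R) :
  (forall k, 0 <= a k) -> orthonormal_family u -> orthonormal_family v ->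
  exists n (e : 'I_n -> H) (s : 'I_n -> R),
    [/\ orthonormal_family e, forall i, `|s i| <= 1 &
    2 * (\sum_k a k ^+ 2) - 2 * (\sum_k \sum_l a k * a l * normsq (inner (v k) (u l)))
    <= \sum_k a k ^+ 2 * (quadratic_test e s (v k) - quadratic_test e s (u k))].
Proof.
move=> a0 ou ov.
(* The difference [B - A] is a single real combination of [m + m] rank one operators, so it can be
   diagonalized as one operator. *)
pose z (i : 'I_(m + m)) := match fintype.split i with inl k => v k | inr k => u k end.
pose c (i : 'I_(m + m)) := match fintype.split i with inl k => a k | inr k => - a k end.
have [n [e [l [oe zE _]]]] := finite_rank_diagonalization z c.
have {zE}zE x y : \sum_k (a k)%:C * (inner x (v k) * inner (v k) y)
     - \sum_k (a k)%:C * (inner x (u k) * inner (u k) y)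
    = \sum_i (l i)%:C * (inner x (e i) * inner (e i) y).
  rewrite -zE big_split_ord/= -sumrN; congr (_ + _); apply: eq_bigr => k _.
    by rewrite /c /z (fintype.unsplitK (inl k)).
  by rewrite /c /z (fintype.unsplitK (inr k)) rmorphN/= mulNr.
pose F (w : 'I_m -> H) x := \sum_k a k * normsq (inner (w k) x).
have zR x : F v x - F u x = \sum_i l i * normsq (inner (e i) x).
  by apply: complexI; rewrite rmorphB/= -!hermitian_form_sum zE.
have F0 w x : 0 <= F w x by apply: sumr_ge0 => k _; rewrite mulr_ge0 ?normsq_ge0.
have lE i : l i = F v (e i) - F u (e i).
  rewrite zR (bigD1 i)//= big1 => [|j ji]; rewrite oe ?eqxx ?(negbTE ji).
    by rewrite normsq_real expr1n mulr1 addr0.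
  by rewrite normsq_real expr0n mulr0.
have Fw w k : orthonormal_family w -> F w (w k) = a k.
  move=> ow; rewrite /F (bigD1 k)//= big1 => [|j jk]; rewrite ow ?eqxx ?(negbTE jk).
    by rewrite normsq_real expr1n mulr1 addr0.
  by rewrite normsq_real expr0n mulr0.
have sqE i : \sum_k a k ^+ 2 * normsq (inner (v k) (e i)) -
    \sum_k a k ^+ 2 * normsq (inner (u k) (e i)) = l i * (F v (e i) + F u (e i)).
  rewrite !sum_sqr_normsq//; set wv := \sum_k _; set wu := \sum_k _.
  (* The vectors [wv] and [wu] are [B e_i] and [A e_i]; pairing the diagonalization of [B - A] with
     [e_i] compares them. *)
  have -> : wv = wu + (l i)%:C *: e i.
    apply: inner_ext => y; rewrite innerDl innerZl; apply/eqP; rewrite addrC -subr_eq; apply/eqP.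
    have := zE (e i) y; rewrite [RHS](bigD1 i)//= [X in _ = _ + X]big1 => [|j ji]; last first.
      by rewrite oe eq_sym (negbTE ji) mul0r mulr0.
    rewrite oe eqxx mul1r addr0 => <-; congr (_ - _);
    by rewrite inner_suml; apply: eq_bigr => k _; rewrite innerZl mulrA.
  rewrite hnorm_sqrD hnormZ (orthonormal_hnorm _ oe) mulr1 real_normK ?num_real//.
  rewrite innerZr -[_^*]/((l i)%:C^*)%C conjc_real.
  have -> : inner wu (e i) = (F u (e i))%:C.
    rewrite -hermitian_form_sum inner_suml; apply: eq_bigr => k _.
    by rewrite innerZl mulrA.
  rewrite -rmorphM/= lE; ring.
exists n, e, (fun i => Num.sg (l i)); split=> //.
  by move=> i; rewrite normr_sg; case: (_ == _).
have -> : \sum_k a k ^+ 2 * (quadratic_test e (fun i => Num.sg (l i)) (v k)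
      - quadratic_test e (fun i => Num.sg (l i)) (u k)) =
    \sum_i Num.sg (l i) * (l i * (F v (e i) + F u (e i))).
  under eq_bigr do rewrite -sumrB big_distrr/=.
  rewrite exchange_big; apply: eq_bigr => i _; rewrite -sqE -sumrB big_distrr/=.
  by apply: eq_bigr => k _; ring.
have -> : 2 * (\sum_k a k ^+ 2) -
    2 * (\sum_k \sum_l a k * a l * normsq (inner (v k) (u l))) = \sum_i l i ^+ 2.
  have -> : \sum_i l i ^+ 2 = \sum_k a k * (F v (v k) - F u (v k))
      - \sum_k a k * (F v (u k) - F u (u k)).
    under [X in _ = X - _]eq_bigr do rewrite zR big_distrr/=.
    under [X in _ = _ - X]eq_bigr do rewrite zR big_distrr/=.
    rewrite exchange_big [X in _ = _ - X]exchange_big -sumrB; apply: eq_bigr => i _.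
    rewrite expr2 {2}lE /F -!sumrB big_distrr/=; apply: eq_bigr => k _.
    by rewrite ![normsq (inner (e i) _)]normsq_innerC; ring.
  under [X in _ = X - _]eq_bigr do rewrite Fw// mulrBr -expr2.
  under [X in _ = _ - X]eq_bigr do rewrite [F u _]Fw// mulrBr -expr2.
  rewrite !sumrB.
  set S := \sum_k \sum_l _; set T := \sum_k a k ^+ 2.
  have -> : \sum_i a i * F u (v i) = S.
    apply: eq_bigr => k _; rewrite big_distrr/=; apply: eq_bigr => i _.
    by rewrite normsq_innerC mulrA.
  have -> : \sum_i a i * F v (u i) = S.
    rewrite /S exchange_big; apply: eq_bigr => k _; rewrite big_distrr/=.
    by apply: eq_bigr => i _; ring.
  ring.
apply: ler_sum => i _; rewrite mulrA -normrEsg -real_normK ?num_real// expr2.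
rewrite ler_wpM2l// {1}lE (le_trans (ler_normB _ _))// !ger0_norm//.
Qed.

Lemma quadratic_test_bound n (e : 'I_n -> H) (s : 'I_n -> R) x :
  orthonormal_family e -> (forall i, `|s i| <= 1) ->
  `|quadratic_test e s x| <= hnorm x ^+ 2.
Proof.
move=> oe s1; apply: le_trans (bessel x oe); apply: le_trans (ler_norm_sum _ _ _) _.
apply: ler_sum => i _; rewrite normrM [`|normsq _|]ger0_norm ?normsq_ge0//.
by rewrite ler_piMl ?normsq_ge0.
Qed.

Lemma quadratic_test_lipschitz n (e : 'I_n -> H) (s : 'I_n -> R) x y :
  orthonormal_family e -> (forall i, `|s i| <= 1) ->
  `|quadratic_test e s x - quadratic_test e s y| <= hnorm (x - y) * hnorm (x + y).
Proof.
move=> oe s1; set d := hnorm (x - y); set t := hnorm (x + y).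
have d0 : 0 <= d := hnorm_ge0 _; have t0 : 0 <= t := hnorm_ge0 _.
pose p i : R := complex.Re (inner (x - y) (e i) * (inner (x + y) (e i))^*).
have pE i : normsq (inner x (e i)) - normsq (inner y (e i)) = p i.
  rewrite /p innerBl innerDl; case: (inner x (e i)) (inner y (e i)) => [a b] [a' b'].
  by rewrite /normsq /=; simpc => /=; ring.
rewrite /quadratic_test -sumrB (eq_bigr (fun i => s i * p i)) => [|i _]; last first.
  by rewrite -pE mulrBr.
(* the sum is [Re <x - y, w>] with [w] of norm at most [t] *)
pose w := \sum_i ((s i)%:C * inner (x + y) (e i)) *: e i.
have -> : \sum_i s i * p i = complex.Re (inner (x - y) w).
  rewrite inner_sumr raddf_sum; apply: eq_bigr => i _; rewrite innerZr rmorphM/=.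
  rewrite /p -[_^* as X in X * _]/((s i)%:C^*)%C conjc_real.
  case: (inner _ _) (_^*) => [a b] [a' b']; by simpc => /=; ring.
have wt : hnorm w <= t.
  rewrite -(@ler_pXn2r _ 2) ?nnegrE ?hnorm_ge0// hnorm_sqr_orthonormal//.
  apply: le_trans (bessel (x + y) oe); apply: ler_sum => i _.
  rewrite normsqM ler_piMl ?normsq_ge0// normsq_real -real_normK ?num_real//.
  by rewrite exprn_ile1.
rewrite ler_norml; apply/andP; split.
  rewrite lerNl -raddfN/= innerBl opprB -innerBl.
  by rewrite (le_trans (Re_inner_le _ _))// Defs.hnormB ler_wpM2l.
by rewrite (le_trans (Re_inner_le _ _))// ler_wpM2l.
Qed.

End powers_stormer.

(** * Reiter's condition for amenable groups *)

(** Minimizes [phi], the squared distance to the orthant of vectors with all coordinates at least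
    [e]. If the infimum were positive, the shortfalls of a near minimizer, normalized to weights,
    would provide a point [b] of [A] towards which [phi] decreases below its infimum. The loss from
    [e] to [e / 2] pays for the infimum not being attained, as [A] need not be closed. *)
Lemma convex_minimax (R : realType) m (A : set ('I_m -> R)) (B e : R) :
  0 < e -> A !=set0 -> (forall a j, A a -> `|a j| <= B) ->
  (forall a b t, A a -> A b -> 0 <= t <= 1 -> A (fun j => a j + t * (b j - a j))) ->
  (forall w : 'I_m -> R, (forall j, 0 <= w j) -> \sum_j w j = 1 ->
     exists2 a, A a & e <= \sum_j w j * a j) ->
  exists2 a, A a & forall j, e / 2 <= a j.
Proof.
move=> e0 [a0 Aa0] AB Ac Aw.
pose p (a : 'I_m -> R) j := Num.max (e - a j) 0.
pose phi a := \sum_j p a j ^+ 2.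
have p0 a j : 0 <= p a j by rewrite le_max lexx orbT.
have phi0 a : 0 <= phi a by apply: sumr_ge0 => j _; exact: sqr_ge0.
pose s := inf [set phi a | a in A].
have hinf : has_inf [set phi a | a in A].
  by split; [exists (phi a0), a0|exists 0 => _ [a _ <-]].
have s_le a : A a -> s <= phi a by move=> Aa; apply: ge_inf; [case: hinf|exists a].
have s0 : 0 <= s by apply: lb_le_inf; [case: hinf|move=> _ [a _ <-]].
have [s_gt0|s_le0] := ltP 0 s; last first.
  (* When the infimum is not positive, a value of [phi] below [(e / 2)^2] leaves every shortfall
     below [e / 2]. *)
  have e2 : 0 < (e / 2) ^+ 2 by rewrite exprn_gt0// divr_gt0.
  have [_ [a Aa <-]] := inf_adherent e2 hinf; rewrite -/s => phia.
  exists a => // j; rewrite leNgt; apply/negP => aj.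
  suff : (e / 2) ^+ 2 < (e / 2) ^+ 2 by rewrite ltxx.
  apply: (le_lt_trans _ (lt_le_trans phia _)); last by lra.
  apply: (@le_trans _ _ (p a j ^+ 2)).
    rewrite ler_pXn2r ?nnegrE ?p0 ?divr_ge0 ?(ltW e0)//.
    by rewrite le_max; apply/orP; left; lra.
  by rewrite /phi (bigD1 j)//= lerDl sumr_ge0// => k _; exact: sqr_ge0.
(* [S] bounds the squared distance between two points of [A], so that the second order term at step
   [t = s / S] is at most [t s]. The summands [s + 1] ensure [t <= 1] and [S > 0]. *)
exfalso; pose S := m%:R * (B + B) ^+ 2 + s + 1.
have S0 : 0 < S by rewrite ltr_wpDl// addr_ge0// mulr_ge0 ?sqr_ge0.
pose t := s / S.
have t0 : 0 < t by rewrite divr_gt0.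
have t1 : t <= 1.
  rewrite ler_pdivrMr// mul1r /S -addrA addrCA lerDl.
  by rewrite addr_ge0// mulr_ge0 ?sqr_ge0.
have [_ [a Aa <-]] := inf_adherent (mulr_gt0 t0 s_gt0) hinf; rewrite -/s => phia.
pose w := p a; pose W := \sum_j w j.
have W0 : 0 < W.
  have W_ge0 : 0 <= W by apply: sumr_ge0 => j _; exact: p0.
  rewrite lt_neqAle W_ge0 andbT eq_sym psumr_eq0 => [|j _]; last exact: p0.
  apply/negP => /allP w0; suff : phi a = 0.
    by move=> h; have := s_le _ Aa; rewrite h leNgt s_gt0.
  rewrite /phi big1// => j _; have := w0 j; rewrite mem_index_enum /w => /(_ isT)/eqP ->.
  by rewrite expr0n.
have [j||b Ab] := Aw (fun j => w j / W).
- by rewrite divr_ge0 ?(ltW W0)//; exact: p0.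
- by rewrite -mulr_suml mulfV// gt_eqF.
under eq_bigr do rewrite mulrAC; rewrite -mulr_suml ler_pdivlMr// => wb.
pose c j := a j + t * (b j - a j).
have Ac' : A c by apply: Ac => //; rewrite ltW.
have := s_le _ Ac'; rewrite leNgt => /negP; apply.
apply: (@le_lt_trans _ _ (\sum_j (w j - t * (b j - a j)) ^+ 2)).
  apply: ler_sum => j _; rewrite -[leRHS]real_normK ?num_real//.
  rewrite ler_pXn2r ?nnegrE ?p0 ?normr_ge0//.
  rewrite /p /c ge_max normr_ge0 andbT; apply: le_trans (ler_norm _).
  by rewrite opprD addrA lerB// /w /p le_max lexx.
(* The linear term is at least [2 t phi(a) >= 2 t s]. It offsets the second order term [t s] and the
   excess of [phi a] over [s], which is less than [t s]. *)
have -> : \sum_j (w j - t * (b j - a j)) ^+ 2 =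
    phi a - 2 * t * \sum_j w j * (b j - a j) + t ^+ 2 * \sum_j (b j - a j) ^+ 2.
  rewrite !mulr_sumr -sumrN -!big_split/=; apply: eq_bigr => j _; rewrite /w; ring.
have h1 : phi a <= \sum_j w j * (b j - a j).
  apply: (@le_trans _ _ (\sum_j w j * (e - a j))).
    apply: ler_sum => j _; rewrite expr2 /w.
    have [ea|ea] := leP 0 (e - a j); first by rewrite /p max_l// lexx.
    by rewrite /p max_r ?(ltW ea)// !mul0r lexx.
  under eq_bigr do rewrite mulrBr; under [leRHS]eq_bigr do rewrite mulrBr.
  by rewrite !sumrB lerB// -mulr_suml mulrC.
have h2 : \sum_j (b j - a j) ^+ 2 <= S.
  apply: (@le_trans _ _ (m%:R * (B + B) ^+ 2)); last by rewrite /S -addrA lerDl addr_ge0.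
  rewrite -[m in m%:R]card_ord mulr_natl -sumr_const; apply: ler_sum => j _.
  rewrite -real_normK ?num_real// ler_pXn2r ?nnegrE//.
    by rewrite (le_trans (ler_normB _ _))// lerD// AB.
  by rewrite addr_ge0// (le_trans (normr_ge0 (a j)))// AB.
have h3 : t ^+ 2 * \sum_j (b j - a j) ^+ 2 <= t * s.
  rewrite (le_trans (ler_wpM2l _ h2)) ?sqr_ge0// expr2 -mulrA ler_wpM2l ?(ltW t0)//.
  by rewrite /t divfK// gt_eqF.
have h4 : t * s <= t * phi a by rewrite ler_wpM2l ?(ltW t0)// s_le.
have h5 : t * phi a <= t * \sum_j w j * (b j - a j) by rewrite ler_wpM2l ?(ltW t0).
lra.
Qed.

(** * Product and subspace topologies *)

Lemma prod_topology_continuous (Y : topologicalType) (I : Type) (T : I -> topologicalType)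
    (phi : Y -> prod_topology T) :
  (forall i, continuous (fun y => phi y i)) -> continuous phi.
Proof.
move=> h y; apply/cvg_sup => i U [_ [[W oW <-] /= Wt WU]].
by apply: filterS WU _; apply: h; exact: open_nbhs_nbhs.
Qed.

Lemma prod_topology_proj_continuous (I : Type) (T : I -> topologicalType) i :
  continuous (fun x : prod_topology T => x i).
Proof.
move=> x U xU; have /cvg_sup/(_ i) : nbhs x --> x by exact: cvg_id.
by apply; exact: (@initial_continuous _ _ (fun f : prod_topology T => f i)).
Qed.

Lemma prod_topology_hausdorff (I : Type) (T : I -> topologicalType) :
  (forall i, hausdorff_space (T i)) -> hausdorff_space (prod_topology T).
Proof.
move=> hT; exact: (@hausdorff_product {classic I} T hT).
Qed.

Lemma compact_set_type (T : topologicalType) (A : set T) :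
  compact A -> compact [set: set_type A].
Proof.
move=> cA F FF _.
have [|p [Ap pF]] := cA (set_val @ F) _.
  change (F (set_val @^-1` A)).
  by apply: filterS (@filterT _ F _) => -[x xA] _; exact: set_mem.
exists (exist _ p (mem_set Ap)); split=> // B C FB [_ [[W oW <-] /= Wp WC]].
have [] := pF (set_val @` B) W.
- change (F (set_val @^-1` (set_val @` B))).
  by apply: filterS FB => x Bx; exists x.
- exact: open_nbhs_nbhs.
by move=> _ [[x Bx <-] Wx]; exists x; split=> //; exact: WC.
Qed.

Lemma hausdorff_set_type (T : topologicalType) (A : set T) :
  hausdorff_space T -> hausdorff_space (set_type A).
Proof.
move=> hT p q pq; apply: val_inj; apply: (hT (set_val p) (set_val q)) => B C Bp Cq.
have cv : continuous (set_val : A -> T) by exact: initial_continuous.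
have [x [Bx Cx]] := pq (set_val @^-1` B) (set_val @^-1` C) (cv p B Bp) (cv q C Cq).
by exists (set_val x).
Qed.

(** * Invariant Borel probability measures *)

Lemma continuous_borel_measurable (R : realType) (X : ptopologicalType) (f : X -> R) :
  continuous f ->
  measurable_fun [set: g_sigma_algebraType (@open X)] (f : g_sigma_algebraType (@open X) -> R).
Proof.
move=> /continuousP cf; apply: (measurability _ (RGenOpens.measurableE R)).
move=> _ [_ [x [y ->]] <-]; rewrite setTI; apply: sub_sigma_algebra.
by apply: cf; exact: interval_open.
Qed.

Lemma continuous_borel_map (X Y : ptopologicalType) (f : X -> Y) : continuous f ->
  measurable_fun [set: g_sigma_algebraType (@open X)]
    (f : g_sigma_algebraType (@open X) -> g_sigma_algebraType (@open Y)).
Proof.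
move=> /continuousP cf.
apply: (@measurability _ _ (g_sigma_algebraType (@open X)) (g_sigma_algebraType (@open Y))
  _ _ (@open Y)) => //.
move=> _ [U oU <-]; rewrite setTI; apply: sub_sigma_algebra; exact: cf.
Qed.

Lemma invariant_integral (R : realType) (X : ptopologicalType)
    (mu : probability (g_sigma_algebraType (@open X)) R) (phi : X -> X) (f : X -> R) :
  continuous phi -> continuous f -> (forall x, 0 <= f x) ->
  (forall A : set (g_sigma_algebraType (@open X)), measurable A -> mu (phi @^-1` A) = mu A) ->
  (\int[mu]_x (f (phi x))%:E = \int[mu]_x (f x)%:E)%E.
Proof.
move=> cphi cf f0 inv.
have mphi := continuous_borel_map cphi.
have mf := (measurable_EFinP _ _).2 (continuous_borel_measurable cf).
have := ge0_integral_pushforward mphi mu measurableT mf _.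
rewrite preimage_setT => <- => [|x _]; last by rewrite lee_fin.
apply: eq_measure_integral => A mA _; exact: inv.
Qed.


(** The integral of the sum vanishes by invariance, and it is at least [c] because [mu] has mass
    1. *)
Lemma invariant_measure_sum (R : realType) (X : ptopologicalType) n
    (mu : probability (g_sigma_algebraType (@open X)) R)
    (phi : 'I_n -> X -> X) (f : 'I_n -> X -> R) (c : R) :
  (forall i, continuous (phi i)) -> (forall i, continuous (f i)) ->
  (forall i x, `|f i x| <= 1) ->
  (forall i (A : set (g_sigma_algebraType (@open X))), measurable A ->
    mu (phi i @^-1` A) = mu A) ->
  (forall x, c <= \sum_i (f i (phi i x) - f i x)) -> c <= 0.
Proof.
move=> cphi cf f1 inv cle; rewrite leNgt; apply/negP => c0.
(* The shift by 1 makes every integrand nonnegative and cancels in the differences. *)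
pose g i (x : g_sigma_algebraType (@open X)) := f i x + 1.
have g0 i x : 0 <= g i x by have := f1 i x; rewrite ler_norml /g => /andP[h _]; lra.
have g2 i x : g i x <= 2 by have := f1 i x; rewrite ler_norml /g => /andP[_ h]; lra.
have cg i : continuous (g i : X -> R) by move=> x; exact: (cvgD (cf i x) (cvg_cst (1 : R))).
have mg i : measurable_fun setT (EFin \o g i).
  by apply/measurable_EFinP; exact: (continuous_borel_measurable (cg i)).
have mgphi i : measurable_fun setT (EFin \o (g i \o phi i : g_sigma_algebraType (@open X) -> R)).
  apply/measurable_EFinP; apply: (@continuous_borel_measurable R X).
  by move=> x; exact: (continuous_comp (cphi i x) (cg i (phi i x))).
have gE i : (\int[mu]_x (g i (phi i x))%:E = \int[mu]_x (g i x)%:E)%E.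
  by apply: invariant_integral => //; exact: inv.
have fin i : (\int[mu]_x (g i x)%:E \is a fin_num)%E.
  rewrite ge0_fin_numE; last by apply: integral_ge0 => x _; rewrite lee_fin.
  apply: (@le_lt_trans _ _ (\int[mu]_x (cst 2%:E x))%E).
    apply: ge0_le_integral => //; first by move=> x _; rewrite lee_fin.
    - exact: mg.
    - by move=> x _; rewrite lee_fin.
  by rewrite (integral_cst mu measurableT) [X in (_ * X)%E](@probability_setT _ _ R mu) mule1 ltry.
have mS : measurable_fun [set: g_sigma_algebraType (@open X)] (fun x => \sum_i (g i x)%:E)%E.
  by apply: emeasurable_sum => i; exact: mg.
have mT : measurable_fun [set: g_sigma_algebraType (@open X)]
    (fun x => \sum_i (g i (phi i x))%:E)%E.
  by apply: emeasurable_sum => i; exact: mgphi.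
have : (\int[mu]_x (c%:E + \sum_i (g i x)%:E) <= \int[mu]_x \sum_i (g i (phi i x))%:E)%E.
  apply: ge0_le_integral => //.
  - by move=> x _; rewrite adde_ge0 ?lee_fin ?(ltW c0)// sume_ge0// => i _; rewrite lee_fin.
  - by apply: emeasurable_funD => //; exact: measurable_cst.
  - move=> x _; rewrite !sumEFin -EFinD lee_fin -lerBrDr -sumrB.
    rewrite (le_trans (cle x))//; apply: ler_sum => i _; rewrite /g; lra.
rewrite ge0_integralD//; last 2 first.
- by move=> x _; rewrite lee_fin ltW.
- by move=> x _; rewrite sume_ge0// => i _; rewrite lee_fin.
rewrite !ge0_integral_sum//; last 2 first.
- by move=> i x _; rewrite lee_fin.
- by move=> i x _; rewrite lee_fin.
under [leRHS]eq_bigr do rewrite gE.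
have sfin : (\sum_i \int[mu]_x (g i x)%:E \is a fin_num)%E.
  by apply/sum_fin_numP => i _ _; exact: fin.
rewrite (integral_cst mu measurableT) [X in (_ * X + _)%E](@probability_setT _ _ R mu) mule1.
by rewrite -leeBrDr// subee// lee_fin leNgt c0.
Qed.

Section real_functions.
Context (R : realType) (T : topologicalType).
Implicit Types f g : T -> R.

Lemma continuous_subr f g : continuous f -> continuous g -> continuous (fun x => f x - g x).
Proof. by move=> cf cg x; exact: (cvgB (cf x) (cg x)). Qed.

Lemma continuous_normr f : continuous f -> continuous (fun x => `|f x|).
Proof. by move=> cf x; exact: (cvg_norm (cf x)). Qed.

Lemma closed_le_preimage f (c : R) : continuous f -> closed [set x | f x <= c].
Proof.
move=> cf; rewrite (_ : [set x | _] = f @^-1` [set r | r <= c])//.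
by apply: closed_comp; [move=> x _; exact: cf|exact: closed_le].
Qed.

Lemma closed_ge_preimage f (c : R) : continuous f -> closed [set x | c <= f x].
Proof.
move=> cf; rewrite (_ : [set x | _] = f @^-1` [set r | c <= r])//.
by apply: closed_comp; [move=> x _; exact: cf|exact: closed_ge].
Qed.

End real_functions.

(** * The compact space of Lipschitz functions *)

Section reiter.
Context (R : realType) (G : topologicalGroupType) (d : G -> G -> R).
Hypothesis d_ge0 : forall h h', 0 <= d h h'.
Hypothesis d_mulr : forall h h' k, d (h * k)%g (h' * k)%g <= d h h'.
Hypothesis d_mull : forall h k k', d (h * k)%g (h * k')%g <= d k k'.
Hypothesis d_cont : forall k (e : R), 0 < e -> \forall k' \near k, d k' k < e.
Context (n : nat) (gam : 'I_n -> G).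

Let F := prod_topology (fun _ : 'I_n * G => R : topologicalType).

(** There is one function on G for each [gam i], so that a single weight can handle all the [gam i]
    at once: all functions but one may be taken 0. The constant 2 is the Lipschitz constant of a
    quadratic test along the orbit of a unit vector. *)
Definition lipschitz_ball (x : 'I_n * G -> R) :=
  (forall i, `|x i| <= 1) /\ forall i h h', `|x (i, h) - x (i, h')| <= 2 * d h h'.

Definition drift (x : 'I_n * G -> R) (h : G) : R :=
  \sum_i (x (i, (gam i * h)%g) - x (i, h)).

Lemma lipschitz_ball0 : lipschitz_ball (fun=> 0).
Proof.
by split=> [i|i h h']; rewrite ?subrr normr0// mulr_ge0.
Qed.

Lemma proj_cont i : continuous (fun x : F => x i : R).
Proof. exact: prod_topology_proj_continuous. Qed.

Lemma drift_continuous h : continuous (fun x : F => drift x h : R).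
Proof.
apply: continuous_big => [|i _]; first exact: add_continuous.
exact: (continuous_subr (@proj_cont (i, (gam i * h)%g)) (@proj_cont (i, h))).
Qed.

Lemma lipschitz_ball_closed : closed (lipschitz_ball : set F).
Proof.
rewrite (_ : lipschitz_ball = (\bigcap_i [set x : F | `|x i| <= 1]) `&`
  (\bigcap_(p in [set: 'I_n * (G * G)]) [set x : F |
    `|x (p.1, p.2.1) - x (p.1, p.2.2)| <= 2 * d p.2.1 p.2.2])).
  apply: closedI; apply: closed_bigI => i _; apply: closed_le_preimage.
  - exact: (continuous_normr (@proj_cont i)).
  - exact: (continuous_normr (continuous_subr (@proj_cont (i.1, i.2.1)) (@proj_cont (i.1, i.2.2)))).
apply/seteqP; split=> x [x1 x2]; split=> //.
- by move=> i _; exact: x1.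
- by move=> [i [h h']] _; exact: x2.
- by move=> i; exact: x1.
- by move=> i h h'; exact: (x2 (i, (h, h'))).
Qed.

Lemma lipschitz_ball_compact : compact (lipschitz_ball : set F).
Proof.
apply: subclosed_compact lipschitz_ball_closed
  (@tychonoff ('I_n * G)%type (fun=> R : topologicalType) (fun=> `[-1, 1]%classic) _) _.
  by move=> i; exact: segment_compact.
by move=> x [x1 _] i /=; rewrite in_itv/= -ler_norml.
Qed.

Lemma lipschitz_ball_convex x y (t : R) : lipschitz_ball x -> lipschitz_ball y ->
  0 <= t <= 1 -> lipschitz_ball (fun i => x i + t * (y i - x i)).
Proof.
move=> [x1 x2] [y1 y2] /andP[t0 t1].
have conv (a b c : R) : `|a| <= c -> `|b| <= c -> `|a + t * (b - a)| <= c.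
  move=> ac bc; rewrite (_ : a + _ = (1 - t) * a + t * b); last by ring.
  rewrite (le_trans (ler_normD _ _))// !normrM (ger0_norm t0) [`|1 - t|]ger0_norm ?subr_ge0//.
  rewrite (_ : c = (1 - t) * c + t * c); last by ring.
  by rewrite lerD// ler_wpM2l// subr_ge0.
split=> [i|i h h']; first exact: conv.
rewrite (_ : _ - _ = (x (i, h) - x (i, h')) +
  t * ((y (i, h) - y (i, h')) - (x (i, h) - x (i, h')))); last by ring.
exact: conv.
Qed.

Lemma drift_convex x y (t : R) h :
  drift (fun i => x i + t * (y i - x i)) h = drift x h + t * (drift y h - drift x h).
Proof.
rewrite /drift -sumrB mulr_sumr -big_split/=; apply: eq_bigr => i _; ring.
Qed.

Lemma drift_bound x h : lipschitz_ball x -> `|drift x h| <= n%:R * 2.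
Proof.
move=> [x1 _]; apply: le_trans (ler_norm_sum _ _ _) _.
rewrite -[n in leRHS]card_ord mulr_natl -sumr_const; apply: ler_sum => i _.
by rewrite (le_trans (ler_normB _ _))// (_ : 2 = 1 + 1)// lerD.
Qed.

Section witness.
Context (e : R).
Hypothesis e0 : 0 < e.
Hypothesis no_reiter : forall m (h : 'I_m -> G) (w : 'I_m -> R),
  (forall j, 0 <= w j) -> \sum_j w j = 1 ->
  exists2 x, lipschitz_ball x & e <= \sum_j w j * drift x (h j).

(* Minimax turns the functions provided for each weight into a single function. *)
Lemma finite_drift m (h : 'I_m -> G) :
  exists2 x, lipschitz_ball x & forall j, e / 2 <= drift x (h j).
Proof.
have [|||w w0 w1|_ [x Lx <-] hx] := @convex_minimax R m
    [set (fun j => drift x (h j)) | x in lipschitz_ball] (n%:R * 2) e e0.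
- by exists (fun j => drift (fun=> 0) (h j)); exists (fun=> 0) => //; exact: lipschitz_ball0.
- by move=> _ j [x Lx <-]; exact: drift_bound.
- move=> _ _ t [x Lx <-] [y Ly <-] t01; exists (fun i => x i + t * (y i - x i)).
    exact: lipschitz_ball_convex.
  by apply/funext => j; rewrite drift_convex.
- have [x Lx hx] := no_reiter h w0 w1.
  by exists (fun j => drift x (h j)) => //; exists x.
by exists x.
Qed.

Definition drift_set : set F :=
  [set x | lipschitz_ball x /\ forall h, e / 2 <= drift x h].

(** The drift condition at finitely many points is satisfiable by [finite_drift]. These conditions
    generate a filter on the compact Lipschitz ball, and each of them is closed, so a cluster point
    satisfies all of them. *)
Lemma drift_set_neq0 : drift_set !=set0.
Proof.
pose B (s : seq G) : set F := [set x | lipschitz_ball x /\ forall h, h \in s -> e / 2 <= drift x h].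
have BF : ProperFilter (filter_from [set: seq G] B).
  apply: filter_from_proper; first apply: filter_from_filter.
  - by exists [::].
  - move=> s t _ _; exists (s ++ t) => // x [Lx hx]; split; split=> // h hs; apply: hx;
    by rewrite mem_cat hs ?orbT.
  move=> s _; have [x Lx hx] := finite_drift (fun j : 'I_(size s) => nth 1%g s j).
  exists x; split=> // h hs; have := hs; rewrite -index_mem => hi.
  by have := hx (Ordinal hi); rewrite nth_index.
have [|p [Lp pB]] := lipschitz_ball_compact BF.
  by exists [::] => // x [].
exists p; split=> // h.
have cl : closed [set x : F | e / 2 <= drift x h].
  apply: closed_ge_preimage; exact: drift_continuous.
apply: (cl p); move: pB; rewrite clusterE => /(_ [set x : F | e / 2 <= drift x h]); apply.
by exists [:: h] => // x [_]; apply; rewrite inE.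
Qed.

Lemma drift_set_compact : compact drift_set.
Proof.
apply: (subclosed_compact _ lipschitz_ball_compact); last by move=> x [].
rewrite (_ : drift_set = lipschitz_ball `&` \bigcap_h [set x : F | e / 2 <= drift x h]).
  apply: closedI; first exact: lipschitz_ball_closed.
  apply: closed_bigI => h _; apply: closed_ge_preimage; exact: drift_continuous.
by apply/seteqP; split=> x [Lx hx]; split=> // h; [move=> _; exact: hx|exact: (hx h)].
Qed.

(** Right translation by [k] commutes with left multiplication by [gam i], so the drift at [h]
    becomes the drift at [h k]; [d_mulr] preserves the Lipschitz bound. *)
Lemma drift_set_translate k x : drift_set x -> drift_set (fun p => x (p.1, (p.2 * k)%g)).
Proof.
move=> [[x1 x2] hx]; split; first split=> [i|i h h']; first exact: x1.
  by rewrite (le_trans (x2 _ _ _))// ler_wpM2l.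
by move=> h; rewrite (le_trans (hx (h * k)%g))// /drift; under eq_bigr do rewrite mulgA.
Qed.

Definition translate k (x : set_type drift_set) : set_type drift_set :=
  exist (fun y => y \in drift_set) _ (mem_set (drift_set_translate k (set_mem (valP x)))).

(** In each coordinate, changing the function is controlled by pointwise convergence at [h k0].
    Changing [k0] to [k] costs at most [2 d(h k, h k0) <= 2 d(k, k0)], uniformly over the functions
    of the ball. *)
Lemma translate_continuous :
  continuous (fun p : G * set_type drift_set => translate p.1 p.2).
Proof.
apply: continuous_comp_initial; apply: prod_topology_continuous => -[i h] [k0 x0] /=.
apply/cvgrPdist_lt => eps eps0.
have eps4 : 0 < eps / 4 by rewrite divr_gt0.
have eps2 : 0 < eps / 2 by rewrite divr_gt0.
have cval : continuous (set_val : set_type drift_set -> F) by exact: initial_continuous.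
have cv : continuous (fun x : set_type drift_set => set_val x (i, (h * k0)%g) : R).
  by move=> x; exact: (continuous_comp (cval x) (@proj_cont (i, (h * k0)%g) (set_val x))).
have /cvgrPdist_lt/(_ _ eps2) nx := cv x0.
near=> p => /=.
have px : `|set_val x0 (i, (h * k0)%g) - set_val p.2 (i, (h * k0)%g)| < eps / 2.
  by near: p; exists ([set: G],
       [set x | `|set_val x0 (i, (h * k0)%g) - set_val x (i, (h * k0)%g)| < eps / 2]);
     [split => //=; exact: filterT|move=> [k x] []].
have pk : d p.1 k0 < eps / 4.
  by near: p; exists ([set k | d k k0 < eps / 4], setT);
     [split => //=; [exact: d_cont|exact: filterT]|move=> [k x] []].
have [[_ x2] _] := set_mem (valP p.2).
rewrite -(subrKA (set_val p.2 (i, (h * k0)%g))) (le_lt_trans (ler_normD _ _))//.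
rewrite (splitr eps) ltr_leD// distrC (le_trans (x2 _ _ _))//.
rewrite (le_trans (ler_wpM2l _ (d_mull _ _ _)))//; lra.
Unshelve. all: by end_near. Qed.

(** Let [f_i] be evaluation at [(i, 1)]. Then [f_i (translate (gam i) x)] is [x (i, gam i)], so the
    drift of [x] at 1 is [\sum_i (f_i (translate (gam i) x) - f_i x)], which is at least [e / 2]
    everywhere but has integral 0 for an invariant measure. *)
Lemma amenable_drift_false : amenable R G -> False.
Proof.
move=> amG; have [x0 dx0] := drift_set_neq0.
pose X : ptopologicalType := HB.pack (set_type drift_set)
  (isPointed.Build (set_type drift_set) (exist (fun y => y \in drift_set) x0 (mem_set dx0))).
have [|||mu [_ inv]] := amG X translate.
- exact: (compact_set_type drift_set_compact).
- apply: hausdorff_set_type; apply: prod_topology_hausdorff => i; exact: norm_hausdorff.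
- split; last exact: translate_continuous.
  + by move=> x; apply: val_inj; apply/funext => -[i h] /=; rewrite mulg1.
  + by move=> g h x; apply: val_inj; apply/funext => -[i k] /=; rewrite mulgA.
have cval : continuous (set_val : set_type drift_set -> F) by exact: initial_continuous.
have := @invariant_measure_sum R X n mu (fun i => translate (gam i))
  (fun i x => set_val x (i, 1%g)) (e / 2).
rewrite leNgt divr_gt0// => h; apply/notF/h => {h}.
- move=> i x U Ux; have [[A B] [/= Ag Bx] AB] := @translate_continuous (gam i, x) U Ux.
  apply: filterS Bx => z Bz; apply: (AB (gam i, z)); split => //=.
  exact: nbhs_singleton.
- by move=> i x; exact: (continuous_comp (cval x) (@proj_cont (i, 1%g) (set_val x))).
- by move=> i x; have [[x1 _] _] := set_mem (valP x); exact: x1.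
- by move=> i A mA; exact: inv.
- move=> x; have [_ /(_ 1%g)] := set_mem (valP x); rewrite /drift.
  by under eq_bigr do rewrite mulg1 -[X in _ _ (_, X)]mul1g.
Qed.

End witness.

Lemma reiter (e : R) : amenable R G -> 0 < e ->
  exists m (h : 'I_m -> G) (w : 'I_m -> R),
    [/\ forall j, 0 <= w j, \sum_j w j = 1 &
      forall x, lipschitz_ball x -> \sum_j w j * drift x (h j) < e].
Proof.
move=> amG e0; apply: contrapT => no; apply: (amenable_drift_false e0 _ amG) => m h w w0 w1.
apply: contrapT => nox; apply: no; exists m, h, w; split=> // x Lx.
by rewrite ltNge; apply/negP => ex; apply: nox; exists x.
Qed.

End reiter.

(** * Completion of a semi-definite inner product *)

Section cabs.
Context (R : realType).
Implicit Types (z w : R[i]) (e : R).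

Definition cabs z : R := Num.sqrt (normsq z).

Lemma cabsE z : (cabs z)%:C = `|z|.
Proof. by rewrite normc_def. Qed.

Lemma cabs_ge0 z : 0 <= cabs z. Proof. exact: sqrtr_ge0. Qed.

Lemma cabs_sqr z : cabs z ^+ 2 = normsq z.
Proof. by rewrite sqr_sqrtr ?normsq_ge0. Qed.

Lemma cabsD z w : cabs (z + w) <= cabs z + cabs w.
Proof. by rewrite -lecR rmorphD/= !cabsE ler_normD. Qed.

Lemma cabsB z w : cabs (z - w) = cabs (w - z).
Proof. by apply: complexI; rewrite !cabsE distrC. Qed.

Lemma cabsN z : cabs (- z) = cabs z.
Proof. by apply: complexI; rewrite !cabsE normrN. Qed.

Lemma cabsM z w : cabs (z * w) = cabs z * cabs w.
Proof. by apply: complexI; rewrite rmorphM/= !cabsE normrM. Qed.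

Lemma cabsC z : cabs z^* = cabs z.
Proof. by apply: complexI; rewrite !cabsE norm_conjC. Qed.

Lemma cabs0 : cabs 0 = 0.
Proof. by apply: complexI; rewrite cabsE normr0. Qed.

Lemma cabs_eq0 z : cabs z = 0 -> z = 0.
Proof. by move=> h; apply: normr0_eq0; rewrite -cabsE h. Qed.

Lemma cabs_real (a : R) : cabs a%:C = `|a|.
Proof. by rewrite /cabs normsq_real sqrtr_sqr. Qed.

Lemma Re_le_cabs z : `|complex.Re z| <= cabs z.
Proof.
rewrite -(@ler_pXn2r _ 2) ?nnegrE ?cabs_ge0// cabs_sqr real_normK ?num_real//.
exact: Re_sqr_le.
Qed.

Lemma Im_le_cabs z : `|complex.Im z| <= cabs z.
Proof.
rewrite -(@ler_pXn2r _ 2) ?nnegrE ?cabs_ge0// cabs_sqr real_normK ?num_real//.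
by rewrite lerDr sqr_ge0.
Qed.

Lemma cabs_le_ReIm z : cabs z <= `|complex.Re z| + `|complex.Im z|.
Proof.
rewrite -(@ler_pXn2r _ 2) ?nnegrE ?cabs_ge0 ?addr_ge0// cabs_sqr sqrrD.
rewrite !real_normK ?num_real// /normsq addrAC lerDl.
by rewrite mulrn_wge0// mulr_ge0.
Qed.

Lemma cabs_small_eq0 z (M : R) : (forall e, 0 < e -> cabs z <= M * e) -> z = 0.
Proof.
move=> h; apply: cabs_eq0; apply/eqP; rewrite eq_le cabs_ge0 andbT leNgt; apply/negP => z0.
pose N := Num.max M 1; have N1 : 0 < N by rewrite lt_max ltr01 orbT.
have := h _ (divr_gt0 z0 (mulr_gt0 (ltr0n R 2) N1)); rewrite leNgt => /negP; apply.
apply: (@le_lt_trans _ _ (N * (cabs z / (2 * N)))).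
  by rewrite ler_wpM2r ?divr_ge0 ?cabs_ge0 ?mulr_ge0 ?(ltW N1)// le_max lexx.
have -> : N * (cabs z / (2 * N)) = cabs z / 2 by field; rewrite gt_eqF.
by rewrite ltr_pdivrMr// mulr_natr mulr2n ltrDl.
Qed.

(** Passages to the limit are done in this form: an inequality up to [C e] for every positive [e],
    with [C] fixed beforehand and of either sign. *)
Lemma real_small_le (a b C : R) : (forall e, 0 < e -> a <= b + C * e) -> a <= b.
Proof.
move=> h; rewrite leNgt; apply/negP => ba; pose N := Num.max C 1.
have N1 : 0 < N by rewrite lt_max ltr01 orbT.
have d0 : 0 < (a - b) / (2 * N) by rewrite divr_gt0 ?subr_gt0// mulr_gt0.
have := h _ d0; apply/negP; rewrite -ltNge.
apply: (@le_lt_trans _ _ (b + N * ((a - b) / (2 * N)))).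
  by rewrite lerD2l ler_wpM2r ?(ltW d0)// le_max lexx.
have -> : N * ((a - b) / (2 * N)) = (a - b) / 2 by field; rewrite gt_eqF.
lra.
Qed.

Lemma cauchy_converges (u : nat -> R) :
  (forall e, 0 < e -> exists N, forall m n, (N <= m)%N -> (N <= n)%N -> `|u m - u n| <= e) ->
  exists l, forall e, 0 < e -> exists N, forall n, (N <= n)%N -> `|u n - l| <= e.
Proof.
move=> uc; have : cvgn u.
  apply/cauchy_cvgP/cauchy_ballP => e e0; have [N hN] := uc _ (divr_gt0 e0 (ltr0n R 2)).
  exists (u @` [set n | (N <= n)%N], u @` [set n | (N <= n)%N]).
    by split; exists N => // n Nn; exists n.
  move=> [_ _] [/= [m Nm <-] [n Nn <-]]; rewrite -ball_normE /= (le_lt_trans (hN _ _ Nm Nn))//.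
  by rewrite ltr_pdivrMr// mulr_natr mulr2n ltrDl.
move=> /cvgrPdist_le h; exists (limn u) => e /h [N _ hN]; exists N => n Nn.
by rewrite distrC; exact: hN.
Qed.

Lemma cauchy_convergesC (u : nat -> R[i]) :
  (forall e, 0 < e -> exists N, forall m n, (N <= m)%N -> (N <= n)%N -> cabs (u m - u n) <= e) ->
  exists l, forall e, 0 < e -> exists N, forall n, (N <= n)%N -> cabs (u n - l) <= e.
Proof.
move=> uc.
have [|a ha] := @cauchy_converges (fun n => complex.Re (u n)).
  move=> e /uc[N hN]; exists N => m n Nm Nn; rewrite -raddfB.
  by rewrite (le_trans (Re_le_cabs _))// hN.
have [|b hb] := @cauchy_converges (fun n => complex.Im (u n)).
  move=> e /uc[N hN]; exists N => m n Nm Nn; rewrite -raddfB.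
  by rewrite (le_trans (Im_le_cabs _))// hN.
exists (a +i* b) => e e0; have e2 : 0 < e / 2 by rewrite divr_gt0.
have [N1 h1] := ha _ e2; have [N2 h2] := hb _ e2; exists (maxn N1 N2) => n.
rewrite geq_max => /andP[/h1 {}h1 /h2 {}h2]; rewrite (le_trans (cabs_le_ReIm _))//.
by rewrite (splitr e) !raddfB/= lerD.
Qed.

Lemma invn_small e : 0 < e -> exists N, forall n, (N <= n)%N -> (n.+1%:R^-1 : R) <= e.
Proof.
move=> /ltr_add_invr[N]; rewrite add0r => hN; exists N => n Nn.
by rewrite (le_trans _ (ltW hN))// lef_pV2 ?posrE ?ltr0n// ler_nat.
Qed.

End cabs.

(* No module axioms are required: the completion restores them. *)
Record preInner (R : realType) := PreInner {
  pi_sort :> Type;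
  pi_add : pi_sort -> pi_sort -> pi_sort;
  pi_scale : R[i] -> pi_sort -> pi_sort;
  pi_zero : pi_sort;
  pi_form : pi_sort -> pi_sort -> R[i];
  pi_formD : forall x y z, pi_form (pi_add x y) z = pi_form x z + pi_form y z;
  pi_formZ : forall a x z, pi_form (pi_scale a x) z = a * pi_form x z;
  pi_form0 : forall z, pi_form pi_zero z = 0;
  pi_formC : forall x y, pi_form x y = (pi_form y x)^*;
  pi_form_ge0 : forall x, 0 <= pi_form x x }.

Section completion.
Context (R : realType) (L : preInner R).
Implicit Types (l v : L) (f g : L -> R[i]) (e M : R).
Local Notation ip := (@pi_form R L).

Definition sn l : R := Num.sqrt (complex.Re (ip l l)).

Lemma sn_ge0 l : 0 <= sn l. Proof. exact: sqrtr_ge0. Qed.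

Lemma snE l : ip l l = (sn l ^+ 2)%:C.
Proof.
have h := pi_form_ge0 l; rewrite sqr_sqrtr ?RRe_real ?ger0_real//.
by rewrite -ler0c RRe_real ?ger0_real.
Qed.

Lemma pi_formDr l v v' : ip l (pi_add v v') = ip l v + ip l v'.
Proof. by rewrite pi_formC pi_formD rmorphD/= -!pi_formC. Qed.

Lemma pi_formZr a l v : ip l (pi_scale a v) = a^* * ip l v.
Proof. by rewrite pi_formC pi_formZ rmorphM/= -pi_formC. Qed.

Lemma pi_cauchy_schwarz l v : cabs (ip l v) <= sn l * sn v.
Proof.
rewrite -(@ler_pXn2r _ 2) ?nnegrE ?mulr_ge0 ?cabs_ge0 ?sn_ge0// cabs_sqr exprMn.
rewrite -lecR normsqE rmorphM/= -!snE.
apply: discriminant_le; rewrite ?pi_form_ge0// => a.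
have := pi_form_ge0 (pi_add l (pi_scale a v)).
rewrite pi_formD !pi_formDr !pi_formZ !pi_formZr -pi_formC.
by congr (0 <= _); rewrite normCK; ring.
Qed.

Definition pi_sub l v := pi_add l (pi_scale (-1) v).

Lemma pi_form_sub l l' v : ip (pi_sub l l') v = ip l v - ip l' v.
Proof. by rewrite pi_formD pi_formZ mulN1r. Qed.

Lemma sn_le l e : 0 <= e -> (forall v, cabs (ip l v) <= e * sn v) -> sn l <= e.
Proof.
move=> e0 /(_ l); rewrite snE cabs_real ger0_norm ?sqr_ge0// expr2.
have [->//|/negbTE s0] := eqVneq (sn l) 0.
by rewrite ler_pM2r// lt_neqAle eq_sym s0 sn_ge0.
Qed.

(** Distance at most [e] from [f] to the functional of [l] in the norm dual to [sn], written without
    a supremum. *)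
Definition near_form f l e := 0 <= e /\ forall v, cabs (f v - ip l v) <= e * sn v.
Definition bounded_form f M := 0 <= M /\ forall v, cabs (f v) <= M * sn v.

(* The completion consists of the antilinear functionals on [L] which are limits of the functionals
   [pi_form l], in the norm dual to [sn]. *)
Definition completion_pred : {pred L -> R[i]} :=
  [pred f | `[< forall e, 0 < e -> exists l, near_form f l e >]].

Lemma completionP f : reflect (forall e, 0 < e -> exists l, near_form f l e)
  (f \in completion_pred).
Proof. exact: asboolP. Qed.

Lemma near_form_ip l : near_form (ip l) l 0.
Proof. by split=> // v; rewrite subrr cabs0 mul0r. Qed.

Lemma near_formP f g l l' e e' a : near_form f l e -> near_form g l' e' ->
  near_form (a *: f + g) (pi_add (pi_scale a l) l') (cabs a * e + e').
Proof.
move=> [e0 fl] [e'0 gl']; split=> [|v]; first by rewrite addr_ge0// mulr_ge0// cabs_ge0.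
rewrite pi_formD pi_formZ [X in X - _](_ : _ = a * f v + g v)//.
rewrite (_ : _ - _ = a * (f v - ip l v) + (g v - ip l' v)); last by ring.
by rewrite (le_trans (cabsD _ _))// cabsM mulrDl lerD// -mulrA ler_wpM2l ?cabs_ge0.
Qed.

Lemma completion_submod : submod_closed completion_pred.
Proof.
split=> [|a f g /completionP fK /completionP gK].
  apply/completionP => e e0; exists (pi_zero L); split=> [|v]; first exact: ltW.
  by rewrite pi_form0 subrr cabs0 mulr_ge0 ?sn_ge0// ltW.
apply/completionP => e e0; pose d := e / (2 * (cabs a + 1)).
have a1 : 0 < cabs a + 1 by rewrite ltr_wpDl ?cabs_ge0.
have d0 : 0 < d by rewrite divr_gt0// mulr_gt0.
have [l fl] := fK _ d0; have [l' gl'] := gK _ (divr_gt0 e0 (ltr0n R 2)).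
exists (pi_add (pi_scale a l) l'); have [_ h] := near_formP a fl gl'.
split=> [|v]; first exact: ltW.
apply: (le_trans (h v)); rewrite ler_wpM2r ?sn_ge0// [leRHS](splitr e) lerD2r.
apply: (@le_trans _ _ ((cabs a + 1) * d)); first by rewrite ler_wpM2r ?lerDl// ltW.
by rewrite (_ : _ * d = e / 2)// /d; field; rewrite gt_eqF.
Qed.

End completion.

Section completion_form.
Context (R : realType) (L : preInner R).
Implicit Types (l v : L) (f g : L -> R[i]) (e M : R).
Local Notation ip := (@pi_form R L).
Local Notation K := (@completion_pred R L).

Lemma near_form_bound f l e : near_form f l e -> bounded_form f (sn l + e).
Proof.
move=> [e0 h]; split=> [|v]; first by rewrite addr_ge0 ?sn_ge0.
rewrite -(subrK (ip l v) (f v)) addrC (le_trans (cabsD _ _))// mulrDl lerD//.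
exact: pi_cauchy_schwarz.
Qed.

Lemma near_form_sn f l e M : near_form f l e -> bounded_form f M -> sn l <= M + e.
Proof.
move=> [e0 h] [M0 b]; apply: sn_le => [|v]; first by rewrite addr_ge0.
rewrite mulrDl.
have -> : ip l v = f v + (ip l v - f v) by ring.
by rewrite (le_trans (cabsD _ _))// lerD// cabsB.
Qed.

Lemma completion_bounded f : f \in K -> exists M, bounded_form f M.
Proof. by move=> /completionP/(_ 1 ltr01)[l /near_form_bound h]; exists (sn l + 1). Qed.

Lemma near_form_diff g l l' e e' : near_form g l e -> near_form g l' e' ->
  sn (pi_sub l l') <= e + e'.
Proof.
move=> [e0 h] [e'0 h']; apply: sn_le => [|v]; first exact: addr_ge0.
rewrite pi_form_sub -(subrKA (g v)) (le_trans (cabsD _ _))// mulrDl lerD//.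
by rewrite cabsB.
Qed.

(** The functionals [pi_form l] are additive for [pi_add], and the bound of [near_form] carries this
    to their limits. *)
Lemma completionD f a b : f \in K -> f (pi_add a b) = f a + f b.
Proof.
move=> /completionP fK; apply/eqP; rewrite -subr_eq0; apply/eqP.
apply: (@cabs_small_eq0 _ _ (sn (pi_add a b) + sn a + sn b)) => e /fK[l [_ h]].
have -> : f (pi_add a b) - (f a + f b) = (f (pi_add a b) - ip l (pi_add a b)) +
    (ip l a - f a) + (ip l b - f b) by rewrite pi_formDr; ring.
rewrite (le_trans (cabsD _ _))// !mulrDl; apply: lerD; last by rewrite cabsB mulrC.
rewrite (le_trans (cabsD _ _))//; apply: lerD; first by rewrite mulrC.
by rewrite cabsB mulrC.
Qed.

Lemma completionZ f c a : f \in K -> f (pi_scale c a) = c^* * f a.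
Proof.
move=> /completionP fK; apply/eqP; rewrite -subr_eq0; apply/eqP.
apply: (@cabs_small_eq0 _ _ (sn (pi_scale c a) + cabs c * sn a)) => e /fK[l [_ h]].
have -> : f (pi_scale c a) - c^* * f a = (f (pi_scale c a) - ip l (pi_scale c a)) +
    c^* * (ip l a - f a) by rewrite pi_formZr; ring.
rewrite (le_trans (cabsD _ _))// mulrDl; apply: lerD; first by rewrite mulrC.
rewrite cabsM cabsC -mulrA ler_wpM2l ?cabs_ge0// cabsB mulrC; exact: h.
Qed.

Lemma completion_sub f a b : f \in K -> f (pi_sub a b) = f a - f b.
Proof. by move=> fK; rewrite completionD// completionZ// rmorphN rmorph1 mulN1r. Qed.

Lemma near_form_eval f g l l' e e' M : f \in K -> bounded_form f M ->
  near_form g l e -> near_form g l' e' -> cabs (f l - f l') <= M * (e + e').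
Proof.
move=> fK [M0 b] gl gl'; rewrite -completion_sub// (le_trans (b _))// ler_wpM2l//.
exact: near_form_diff gl gl'.
Qed.

(* [z] is the limit of [f l] as [pi_form l] tends to [g]. *)
Definition is_inner f g z := forall M l e, bounded_form f M -> near_form g l e ->
  cabs (f l - z) <= M * e.

(** If the functionals of [b n] tend to [g], then the [b n] form a Cauchy sequence for [sn], hence
    so do the values [f (b n)] of the bounded functional [f]. Comparing [b n] with any other
    approximant of [g] gives the estimate required of the limit. *)
Lemma exists_inner f g : f \in K -> g \in K -> exists z, is_inner f g z.
Proof.
move=> fK gK; have r0 n : 0 < n.+1%:R^-1 :> R by rewrite invr_gt0.
have /choice[b hb] : forall n : nat, exists l, near_form g l (n.+1%:R^-1).
  by move=> n; move/completionP : gK; exact.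
have [M fM] := completion_bounded fK; have M0 := fM.1.
have [|z hz] := @cauchy_convergesC R (fun n => f (b n)).
  move=> e e0; have d0 : 0 < e / (2 * (M + 1)) by rewrite divr_gt0// mulr_gt0// ltr_wpDl.
  have [N hN] := invn_small d0; exists N => m n /hN hm /hN hn.
  rewrite (le_trans (near_form_eval fK fM (hb m) (hb n)))//.
  apply: (@le_trans _ _ ((M + 1) * (e / (2 * (M + 1)) + e / (2 * (M + 1))))).
    by rewrite ler_pM ?lerDl// ?lerD// addr_ge0// ltW.
  suff -> : (M + 1) * (e / (2 * (M + 1)) + e / (2 * (M + 1))) = e by [].
  by field; rewrite gt_eqF// ltr_wpDl.
exists z => M' l d fM' gl; apply: (@real_small_le _ _ _ (M' + 1)) => e e0.
have [N1 h1] := hz _ e0; have [N2 h2] := invn_small e0.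
pose n := maxn N1 N2; rewrite -(subrKA (f (b n))) (le_trans (cabsD _ _))//.
have -> : M' * d + (M' + 1) * e = M' * (d + e) + e by ring.
apply: lerD; last by apply: h1; rewrite leq_maxl.
rewrite (le_trans (near_form_eval fK fM' gl (hb n)))// ler_wpM2l ?fM'.1// lerD2l.
by apply: h2; rewrite leq_maxr.
Qed.

HB.instance Definition _ := GRing.isSubmodClosed.Build R[i] (L -> R[i]) K
  (@completion_submod R L).

Definition completion := {f : L -> R[i] | f \in K}.

HB.instance Definition _ := [isSub of completion for sval].
HB.instance Definition _ := [Choice of completion by <:].
HB.instance Definition _ := [SubChoice_isSubLmodule of completion by <:].

Definition completion_form (f g : completion) : R[i] :=
  projT1 (cid (exists_inner (valP f) (valP g))).

Lemma completion_formP (f g : completion) : is_inner (val f) (val g) (completion_form f g).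
Proof. by rewrite /completion_form; case: cid. Qed.

Lemma completion_linear (h : completion) : scalar (completion_form ^~ h).
Proof.
move=> a f g; apply/eqP; rewrite -subr_eq0; apply/eqP.
have [M fM] := completion_bounded (valP f); have [M' gM] := completion_bounded (valP g).
have [M'' afM] := completion_bounded (valP (a *: f + g)).
apply: (@cabs_small_eq0 _ _ (M'' + cabs a * M + M')) => e e0.
have [l hl] := completionP _ (valP h) _ e0.
have h1 := completion_formP fM hl; have h2 := completion_formP gM hl.
have h3 := completion_formP afM hl; move: h3.
rewrite [val (a *: f + g) l](_ : _ = a * val f l + val g l)// => h3.
set z1 := completion_form f h in h1 *; set z2 := completion_form g h in h2 *.
set z3 := completion_form _ h in h3 *.
have -> : z3 - (a * z1 + z2) =
  - (a * val f l + val g l - z3) + a * (val f l - z1) + (val g l - z2) by ring.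
rewrite !mulrDl (le_trans (cabsD _ _))//; apply: lerD => //.
rewrite (le_trans (cabsD _ _))//; apply: lerD; first by rewrite cabsN.
by rewrite cabsM -mulrA ler_wpM2l ?cabs_ge0.
Qed.

(** The constant is fixed before [e], as the limit lemmas require. Approximating to within the
    minimum of [e] and 1 keeps the seminorms of [l] and [l'] bounded. *)
Lemma completion_form_approx (f g : completion) : exists C, forall e, 0 < e ->
  exists l l', [/\ near_form (val f) l e, near_form (val g) l' e, sn l <= C, sn l' <= C &
    cabs (ip l l' - completion_form f g) <= C * e].
Proof.
have [M fM] := completion_bounded (valP f); have [M' gM] := completion_bounded (valP g).
exists (M + (M' + 1)) => e e0; pose d := Num.min e 1.
have d0 : 0 < d by rewrite lt_min e0 ltr01.
have de : d <= e by rewrite ge_min lexx.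
have d1 : d <= 1 by rewrite ge_min lexx orbT.
have [l hl] := completionP _ (valP f) _ d0; have [l' hl'] := completionP _ (valP g) _ d0.
have wk h k : near_form h k d -> near_form h k e.
  by move=> [_ n]; split=> [|v]; [exact: ltW|rewrite (le_trans (n v))// ler_wpM2r ?sn_ge0].
exists l, l'; split; [exact: wk|exact: wk|..].
- have := near_form_sn hl fM; have := gM.1; lra.
- have := near_form_sn hl' gM; have := fM.1; lra.
apply: (@le_trans _ _ ((M + (M' + 1)) * d)); last first.
  by rewrite ler_wpM2l// addr_ge0 ?fM.1// addr_ge0 ?gM.1.
rewrite -(subrKA (val f l')) (le_trans (cabsD _ _))// mulrDl addrC; apply: lerD.
  exact: completion_formP.
rewrite cabsB (le_trans (hl.2 l'))// mulrC ler_wpM2r ?(ltW d0)//.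
by rewrite (le_trans (near_form_sn hl' gM))// lerD2l.
Qed.

Lemma completion_conj (f g : completion) : completion_form f g = (completion_form g f)^*.
Proof.
have [C h] := completion_form_approx f g.
have [M' gM] := completion_bounded (valP g).
apply/eqP; rewrite -subr_eq0; apply/eqP.
apply: (@cabs_small_eq0 _ _ (C + (C + M'))) => e /h[l [l' [fl gl' lC l'C hz]]].
set z := completion_form f g in hz *; have hz' := completion_formP gM fl.
set z' := completion_form g f in hz' *.
have -> : z - z'^* = - (ip l l' - z) + ((ip l' l)^* - (val g l)^*) + ((val g l)^* - z'^*).
  by rewrite -pi_formC; ring.
rewrite (le_trans (cabsD _ _))// [C + (_ + _)]addrA mulrDl.
apply: lerD; last by rewrite -rmorphB cabsC.
rewrite mulrDl.
rewrite (le_trans (cabsD _ _))//; apply: lerD; first by rewrite cabsN.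
rewrite -rmorphB cabsC cabsB (le_trans (gl'.2 l))// mulrC ler_wpM2r//; exact: gl'.1.
Qed.

Lemma completion_form_ge0 (f : completion) : 0 <= completion_form f f.
Proof.
have zR : complex.Im (completion_form f f) = 0.
  have := completion_conj f f; case: (completion_form f f) => a b /=.
  by move=> [/eqP]; rewrite -subr_eq0 opprK -mulr2n mulrn_eq0/= => /eqP.
rewrite lecE zR eqxx/=.
have [C h] := completion_form_approx f f.
have [M fM] := completion_bounded (valP f).
apply: (@real_small_le _ _ _ (C + (C + C))) => e /h[l [l' [fl fl' lC l'C hz]]].
set z := completion_form f f in zR hz *.
have h2 : cabs (ip l l - ip l l') <= (C + C) * e.
  rewrite pi_formC [ip l l']pi_formC -rmorphB cabsC -pi_form_sub.
  rewrite (le_trans (pi_cauchy_schwarz _ _))// mulrC.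
  rewrite (le_trans (ler_pM (sn_ge0 _) (sn_ge0 _) lC (near_form_diff fl fl')))//; lra.
have h3 : 0 <= complex.Re (ip l l) by rewrite snE/= sqr_ge0.
have : cabs (ip l l - z) <= (C + (C + C)) * e.
  by rewrite -(subrKA (ip l l')) (le_trans (cabsD _ _))// mulrDl addrC lerD.
move=> /(le_trans (Re_le_cabs _)); rewrite raddfB/= ler_norml => /andP[_ h4]; lra.
Qed.

Lemma ip_in_completion l : ip l \in K.
Proof.
apply/completionP => e e0; exists l; split; rewrite ?ltW// => v.
by rewrite subrr cabs0 mulr_ge0 ?sn_ge0// ltW.
Qed.

Definition embed l : completion := exist _ (ip l) (ip_in_completion l).

Lemma completion_form_embed (f : completion) l : completion_form f (embed l) = val f l.
Proof.
have [M fM] := completion_bounded (valP f).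
have nl : near_form (val (embed l)) l 0 := near_form_ip l.
have := completion_formP fM nl; rewrite mulr0 => h.
apply/eqP; rewrite eq_sym -subr_eq0; apply/eqP/cabs_eq0/eqP.
by rewrite eq_le cabs_ge0 andbT; exact: h.
Qed.

Lemma completion_formDl (f g h : completion) :
  completion_form (f + g) h = completion_form f h + completion_form g h.
Proof. by rewrite -[f]scale1r completion_linear mul1r scale1r. Qed.

Lemma completion_form0 (h : completion) : completion_form 0 h = 0.
Proof.
by apply: (addrI (completion_form 0 h)); rewrite -completion_formDl !addr0.
Qed.

Lemma completion_formZ a (f h : completion) :
  completion_form (a *: f) h = a * completion_form f h.
Proof. by rewrite -[a *: f]addr0 completion_linear completion_form0 addr0. Qed.

(** Makes Cauchy-Schwarz and the seminorm [sn] available on the completion before it is known to be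
    a Hilbert space. *)
Definition completion_preInner : preInner R := @PreInner R completion
  (fun f g : completion => f + g) (fun a (f : completion) => a *: f) 0 completion_form
  completion_formDl completion_formZ completion_form0
  completion_conj completion_form_ge0.

Local Notation nk := (@sn R completion_preInner).

Lemma completion_norm_embed l : nk (embed l) = sn l.
Proof. by rewrite /sn/= completion_form_embed. Qed.

Lemma completion_norm_bound (f : completion) : bounded_form (val f) (nk f).
Proof.
split=> [|v]; first exact: sn_ge0.
rewrite -completion_form_embed -completion_norm_embed.
exact: (@pi_cauchy_schwarz _ completion_preInner).
Qed.

(** Together with [completion_norm_bound] this identifies the Hilbert norm with the dual norm.
    Evaluating [f] at its own approximants gives [nk f ^ 2 <= M nk f]. *)
Lemma completion_norm_le (f : completion) M : bounded_form (val f) M -> nk f <= M.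
Proof.
move=> fM; have [M0 b] := fM; have [->//|n0] := eqVneq (nk f) 0.
have n_gt0 : 0 < nk f by rewrite lt_neqAle eq_sym n0 sn_ge0.
rewrite -(ler_pM2r n_gt0) -expr2.
apply: (@real_small_le _ _ _ (M + M)) => e e0.
have [l hl] := completionP _ (valP f) _ e0.
have h1 := completion_formP fM hl; have h2 := near_form_sn hl (completion_norm_bound f).
have h3 : completion_form f f = (nk f ^+ 2)%:C := @snE _ completion_preInner f.
have h4 : nk f ^+ 2 <= cabs (completion_form f f) by rewrite h3 cabs_real ger0_norm ?sqr_ge0.
rewrite (le_trans h4)// -[completion_form f f](subKr (val f l)) (le_trans (cabsD _ _))// cabsN.
rewrite (le_trans (lerD (b l) h1))//.
rewrite [leRHS](_ : _ = M * (nk f + e) + M * e); last by ring.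
by rewrite lerD2r ler_wpM2l.
Qed.

(** A functional of norm 0 vanishes at every [v], so vectors of seminorm 0 are identified with 0
    without an explicit quotient. *)
Lemma completion_gt0 (f : completion) : f != 0 -> 0 < completion_form f f.
Proof.
move=> f0; rewrite lt_neqAle completion_form_ge0 andbT eq_sym; apply: contra_neq f0 => h.
apply: val_inj; apply/funext => v; apply: cabs_eq0; apply/eqP.
rewrite eq_le cabs_ge0 andbT (le_trans ((completion_norm_bound f).2 v))//.
by rewrite /sn/= h sqrtr0 mul0r.
Qed.

Lemma completion_complete (u : nat -> completion) :
  (forall e : R, 0 < e -> exists N, forall m n, (N <= m)%N -> (N <= n)%N ->
      completion_form (u m - u n) (u m - u n) <= e%:C) ->
  exists x, forall e : R, 0 < e -> exists N, forall n, (N <= n)%N ->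
      completion_form (u n - x) (u n - x) <= e%:C.
Proof.
move=> uc; have {}uc e : 0 < e -> exists N, forall m n, (N <= m)%N -> (N <= n)%N ->
    forall v, cabs (val (u m) v - val (u n) v) <= e * sn v.
  move=> e0; have [N hN] := uc _ (exprn_gt0 2 e0); exists N => m n Nm Nn v.
  apply: (le_trans ((completion_norm_bound (u m - u n)).2 v)); rewrite ler_wpM2r ?sn_ge0//.
  rewrite -(@ler_pXn2r _ 2) ?nnegrE ?sn_ge0 ?(ltW e0)// -lecR.
  by rewrite -[X in X <= _](@snE _ completion_preInner); exact: hN.
have /choice[F hF] : forall v, exists z, forall e, 0 < e ->
    exists N, forall n, (N <= n)%N -> cabs (val (u n) v - z) <= e.
  move=> v; apply: cauchy_convergesC => e e0.
  have s0 : 0 < sn v + 1 by rewrite ltr_wpDl ?sn_ge0.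
  have [N hN] := uc _ (divr_gt0 e0 s0); exists N => m n Nm Nn.
  rewrite (le_trans (hN m n Nm Nn v))// -mulrA ler_piMr ?(ltW e0)//.
  by rewrite mulrC ler_pdivrMr// mul1r lerDl.
(* The rank [N] is independent of [v]: the Cauchy bound is uniform in [v], and only the auxiliary
   index [k] depends on it. *)
have uF e : 0 < e -> exists N, forall n, (N <= n)%N -> forall v,
    cabs (val (u n) v - F v) <= e * sn v.
  move=> /uc[N hN]; exists N => n Nn v; apply: (@real_small_le _ _ _ 1) => d d0.
  have [N' hN'] := hF v d d0; pose k := maxn N N'.
  rewrite mul1r -(subrKA (val (u k) v)) (le_trans (cabsD _ _))// lerD//.
    by rewrite hN// leq_maxl.
  by rewrite hN'// leq_maxr.
have FK : F \in K.
  apply/completionP => e e0; have e2 : 0 < e / 2 by rewrite divr_gt0.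
  have [N /(_ N (leqnn N)) hN] := uF _ e2.
  have [l [_ hl]] := completionP _ (valP (u N)) _ e2.
  exists l; split=> [|v]; first exact: ltW.
  rewrite -(subrKA (val (u N) v)) (le_trans (cabsD _ _))// (splitr e) mulrDl lerD//.
  by rewrite cabsB.
pose x : completion := exist _ F FK; exists x => e e0.
have s0 : 0 < Num.sqrt e by rewrite sqrtr_gt0.
have [N hN] := uF _ s0; exists N => n Nn.
have : nk (u n - x) <= Num.sqrt e.
  by apply: completion_norm_le; split=> [|v]; [exact: ltW|exact: hN].
rewrite -(@ler_pXn2r _ 2) ?nnegrE ?sn_ge0 ?(ltW s0)// -lecR [X in _ <= X%:C]sqr_sqrtr ?(ltW e0)//.
by rewrite -[X in X <= _](@snE _ completion_preInner).
Qed.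

Definition completion_ips : innerProductSpace R := @InnerProductSpace R completion
  completion_form completion_linear completion_conj completion_gt0 completion_complete.

End completion_form.

Section hilbert_completion.
Context (R : realType) (L : preInner R).

Local Notation K := (ipsT (completion_ips L)).

Lemma completion_hnorm (f : K) : hnorm f = @sn R (completion_preInner L) f.
Proof.
apply/eqP; rewrite -(@eqrXn2 _ 2) ?hnorm_ge0 ?sn_ge0//; apply/eqP/complexI.
by rewrite -innerxx -snE.
Qed.

Lemma inner_embed l l' : inner (embed l : K) (embed l') = pi_form l l'.
Proof. exact: (@completion_form_embed R L (embed l) l'). Qed.

Lemma embed_add l l' : embed (pi_add l l') = embed l + embed l' :> K.
Proof. by apply: val_inj; apply/funext => v; rewrite /= pi_formD. Qed.

Lemma embed_scale a l : embed (pi_scale a l) = a *: (embed l : K).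
Proof. by apply: val_inj; apply/funext => v; rewrite /= pi_formZ. Qed.

Lemma embed_zero : embed (pi_zero L) = 0 :> K.
Proof. by apply: val_inj; apply/funext => v; rewrite /= pi_form0. Qed.

Lemma embed_dense (f : K) (e : R) : 0 < e -> exists l, hnorm (f - embed l) <= e.
Proof.
move=> e0; have [l [_ h]] := completionP _ (valP f) _ e0; exists l.
by rewrite completion_hnorm; apply: completion_norm_le; split=> [|v]; [exact: ltW|exact: h].
Qed.

(* The extension of [al] to the completion is precomposition with its adjoint [be]. *)
Section transport.
Context (al be : L -> L).
Hypothesis adj : forall l v, pi_form (al l) v = pi_form l (be v).
Hypothesis be_iso : forall l v, pi_form (be l) (be v) = pi_form l v.
Hypothesis be_al : forall l, be (al l) = l.

Lemma sn_transport v : sn (be v) = sn v.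
Proof. by rewrite /sn be_iso. Qed.

Lemma near_form_transport (f : L -> R[i]) l e :
  near_form f l e -> near_form (f \o be) (al l) e.
Proof.
move=> [e0 h]; split=> // v; rewrite adj.
by rewrite -sn_transport; exact: h.
Qed.

Lemma transport_in (f : completion L) : val f \o be \in @completion_pred R L.
Proof.
apply/completionP => e e0; have [l hl] := completionP _ (valP f) _ e0.
by exists (al l); exact: near_form_transport.
Qed.

Definition transport (f : K) : K :=
  exist (fun g => g \in @completion_pred R L) _ (transport_in f).

Lemma transport_inner (f g : K) : inner (transport f) (transport g) = inner f g.
Proof.
apply/eqP; rewrite -subr_eq0; apply/eqP.
have [M fM] := completion_bounded (valP f).
have tM : bounded_form (val (transport f)) M.
  by split=> [|v]; [exact: fM.1|rewrite (le_trans (fM.2 _))// sn_transport].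
apply: (@cabs_small_eq0 _ _ (M + M)) => e e0.
have [l hl] := completionP _ (valP g) _ e0.
have h1 := completion_formP fM hl.
have tl : near_form (val (transport g)) (al l) e by exact: near_form_transport.
have h2 := completion_formP tM tl; rewrite /= be_al in h2.
rewrite -(subrKA (val f l)) (le_trans (cabsD _ _))// mulrDl lerD//.
by rewrite cabsB.
Qed.

Lemma transport_embed l : transport (embed l) = embed (al l).
Proof. by apply: val_inj; apply/funext => v; rewrite /= adj. Qed.

End transport.

End hilbert_completion.

(** * Hilbert-Schmidt operators *)

Section hilbert_schmidt.
Context (R : realType) (H : hilbertType R).

Definition hs_form (l l' : seq (R[i] * H)) : R[i] :=
  \sum_(p <- l) \sum_(q <- l') p.1 * q.1^* * (normsq (inner p.2 q.2))%:C.

Lemma hs_formD x y z : hs_form (x ++ y) z = hs_form x z + hs_form y z.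
Proof. by rewrite /hs_form big_cat. Qed.

Definition hs_scale (a : R[i]) (l : seq (R[i] * H)) := [seq (a * p.1, p.2) | p <- l].

Lemma hs_formZ a x z : hs_form (hs_scale a x) z = a * hs_form x z.
Proof.
rewrite /hs_form big_map mulr_sumr; apply: eq_bigr => p _.
by rewrite mulr_sumr; apply: eq_bigr => q _; rewrite !mulrA.
Qed.

Lemma hs_form0 z : hs_form [::] z = 0.
Proof. by rewrite /hs_form big_nil. Qed.

Lemma hs_formC x y : hs_form x y = (hs_form y x)^*.
Proof.
rewrite /hs_form exchange_big rmorph_sum; apply: eq_bigr => q _.
rewrite rmorph_sum; apply: eq_bigr => p _; rewrite !rmorphM/= conjCK.
rewrite normsq_innerC [_^* * _]mulrC; congr (_ * _).
by rewrite -[RHS]/((_%:C)^*)%C conjc_real.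
Qed.

(** In an orthonormal basis of the span of the vectors of the list, [S] is the matrix of the
    operator, and the form is the sum of the squared moduli of its entries. *)
Lemma hs_form_ge0 x : 0 <= hs_form x x.
Proof.
have [n [b [ob bx]]] := exists_orthonormal_span [seq p.2 | p <- x].
pose S i j := \sum_(p <- x) p.1 * (inner p.2 (b i) * (inner p.2 (b j))^*).
rewrite (_ : hs_form x x = \sum_i \sum_j S i j * (S i j)^*).
  by apply: sumr_ge0 => i _; apply: sumr_ge0 => j _; rewrite mul_conjC_ge0.
have inb p q : p \in x -> (normsq (inner p.2 q.2))%:C =
    \sum_i \sum_j (inner p.2 (b i) * (inner p.2 (b j))^*) *
      (inner q.2 (b i) * (inner q.2 (b j))^*)^*.
  move=> px; have pE := parseval q.2 (bx _ (map_f _ px)).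
  rewrite normsq_conj {2}pE {1}pE rmorph_sum mulr_suml; apply: eq_bigr => i _.
  rewrite mulr_sumr; apply: eq_bigr => j _; rewrite !rmorphM/= conjCK.
  by rewrite [inner (b i) _]innerC [inner (b j) _]innerC conjCK; ring.
transitivity (\sum_(p <- x) \sum_(q <- x) \sum_i \sum_j
   (p.1 * (inner p.2 (b i) * (inner p.2 (b j))^*)) *
   (q.1 * (inner q.2 (b i) * (inner q.2 (b j))^*))^*).
  rewrite /hs_form big_seq [RHS]big_seq; apply: eq_bigr => p px; apply: eq_bigr => q _.
  rewrite inb// mulr_sumr; apply: eq_bigr => i _; rewrite mulr_sumr; apply: eq_bigr => j _.
  by rewrite [(q.1 * _)^*]rmorphM/=; ring.
under eq_bigr do rewrite exchange_big.
rewrite exchange_big; apply: eq_bigr => i _.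
under eq_bigr do rewrite exchange_big.
rewrite exchange_big; apply: eq_bigr => j _.
rewrite /S rmorph_sum mulr_suml; apply: eq_bigr => p _.
by rewrite mulr_sumr.
Qed.

(* A list stands for the combination [\sum c x x^*] of its entries [(c, x)], with the trace inner
   product; the completion is the space of Hilbert-Schmidt operators. *)
Definition hs_preInner : preInner R := @PreInner R (seq (R[i] * H)) cat hs_scale [::] hs_form
  hs_formD hs_formZ hs_form0 hs_formC hs_form_ge0.

Definition hs : hilbertType R := ipsT (completion_ips hs_preInner).
Definition rank_one (x : H) : hs := embed ([:: (1, x)] : hs_preInner).

Lemma inner_rank_one x y : inner (rank_one x) (rank_one y) = (normsq (inner x y))%:C.
Proof.
rewrite inner_embed /= /hs_form !big_seq1 /= rmorph1 !mul1r//.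
Qed.

Lemma embed_hs (l : seq (R[i] * H)) :
  embed (l : hs_preInner) = \sum_(p <- l) p.1 *: rank_one p.2 :> hs.
Proof.
elim: l => [|[a x] l IH]; first by rewrite big_nil; exact: embed_zero.
rewrite big_cons -IH -[(a, x) :: l]/(pi_add ([:: (a, x)] : hs_preInner) l) embed_add.
congr (_ + _); rewrite -embed_scale; congr embed.
by rewrite /= /hs_scale/= mulr1.
Qed.

(** With [r] the common norm and [z = <x, y>], the right side minus the left is
    [2 (r^2 - Re z)^2 + 2 (|z|^2 - (Re z)^2)]. *)
Lemma rank_one_lipschitz x y : hnorm x = hnorm y ->
  hnorm (rank_one x - rank_one y) ^+ 2 <= 2 * hnorm x ^+ 2 * hnorm (x - y) ^+ 2.
Proof.
move=> xy; rewrite hnorm_sqrB.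
have nr z : hnorm (rank_one z) ^+ 2 = hnorm z ^+ 4.
  apply: complexI; rewrite -innerxx inner_rank_one innerxx normsq_real.
  by rewrite -exprM.
rewrite !nr inner_rank_one/= hnorm_sqrB -xy; set r := hnorm x; set z := inner x y.
have := Re_sqr_le z; have := sqr_ge0 (r ^+ 2 - complex.Re z).
have -> : r ^+ 4 = r ^+ 2 * r ^+ 2 by rewrite -exprD.
rewrite sqrrB !expr2; lra.
Qed.

End hilbert_schmidt.

(** * The conjugation representation *)

Section hs_unitary.
Context (R : realType) (H : hilbertType R).
Implicit Types (u v : unitary H).

Definition hs_map u (l : hs_preInner H) : hs_preInner H := [seq (p.1, u p.2) | p <- l].

Lemma unitary_adjoint u x y : inner (u x) y = inner x ((u^-1)%g y).
Proof. by rewrite -[in LHS](unitaryVK u y) unitary_inner. Qed.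

Lemma hs_map_comp u v l : hs_map u (hs_map v l) = hs_map (u * v)%g l.
Proof. by rewrite /hs_map -map_comp. Qed.

Lemma hs_map1 l : hs_map 1%g l = l.
Proof. by rewrite /hs_map -[RHS]map_id; apply: eq_map => -[a x]. Qed.

Lemma hs_map_adjoint u l l' : pi_form (hs_map u l) l' = pi_form l (hs_map (u^-1)%g l').
Proof.
rewrite /= /hs_form big_map; apply: eq_bigr => p _; rewrite big_map.
by apply: eq_bigr => q _; rewrite unitary_adjoint.
Qed.

Lemma hs_map_iso u l l' : pi_form (hs_map u l) (hs_map u l') = pi_form l l'.
Proof. by rewrite hs_map_adjoint hs_map_comp mulVg hs_map1. Qed.

Lemma hs_mapVK u l : hs_map (u^-1)%g (hs_map u l) = l.
Proof. by rewrite hs_map_comp mulVg hs_map1. Qed.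

(** On operators this is [T -> u T u^*], which sends [x x^*] to the rank one operator of [u x]. *)
Definition hs_act u : hs H -> hs H :=
  transport (hs_map_adjoint u) (hs_map_iso (u^-1)%g).

Lemma hs_act_unitary u : Defs.is_unitary (hs_act u).
Proof.
split=> [a f g|f g|f]; first by apply: val_inj; apply/funext.
  by apply: transport_inner; exact: hs_mapVK.
exists (hs_act (u^-1)%g f); apply: val_inj; apply/funext => l /=.
by rewrite hs_map_comp mulVg hs_map1.
Qed.

Definition hs_unitary u : unitary (hs H) := Unitary (hs_act_unitary u).

Lemma hs_unitaryM u v : hs_unitary (u * v)%g = (hs_unitary u * hs_unitary v)%g.
Proof.
apply: unitary_eq => f; apply: val_inj; apply/funext => l /=.
by rewrite hs_map_comp -invgM.
Qed.

Lemma hs_unitary_embed u l : hs_unitary u (embed l) = embed (hs_map u l).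
Proof. exact: transport_embed. Qed.

Lemma hs_unitary_rank_one u x : hs_unitary u (rank_one x) = rank_one (u x).
Proof. exact: hs_unitary_embed. Qed.

End hs_unitary.

Lemma continuous_hnormP (R : realType) (H : hilbertType R) (T : topologicalType) (f : T -> H) :
  continuous f <-> forall x (e : R), 0 < e -> \forall y \near x, hnorm (f x - f y) < e.
Proof.
split=> [cf x e e0|h x].
  have /cvgrPdist_lt/(_ e%:C) := cf x; rewrite ltcR => /(_ e0).
  by apply: filterS => y; rewrite hnormE ltcR.
apply/(@cvgrPdist_lt R[i]) => e e0.
have er : e = (complex.Re e)%:C by rewrite RRe_real// gtr0_real.
rewrite er ltcR in e0; apply: filterS (h x _ e0) => y.
by rewrite hnormE er ltcR.
Qed.

Section hs_rep.
Context (R : realType) (H : hilbertType R) (G : topologicalGroupType).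

(** On rank one operators, [rank_one_lipschitz] reduces the claim to strong continuity of [rho]. It
    extends to finite combinations by linearity and to all of [hs H] by density, the operators being
    isometric. *)
Lemma hs_strongly_continuous (rho : G -> unitary H) :
  strongly_continuous rho -> strongly_continuous (fun g => hs_unitary (rho g)).
Proof.
move=> crho f; apply/continuous_hnormP => g0 e e0.
have tau x d : 0 < d -> \forall g \near g0, hnorm (rank_one (rho g0 x) - rank_one (rho g x)) < d.
  move=> d0; have /continuous_hnormP/(_ g0) cx := crho x.
  pose r := hnorm x + 1; have r0 : 0 < r by rewrite ltr_wpDl ?hnorm_ge0.
  have d'0 : 0 < d / (2 * r) by rewrite divr_gt0// mulr_gt0.
  apply: filterS (cx _ d'0) => g; rewrite ltr_pdivlMr ?mulr_gt0// => hg.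
  rewrite -(@ltr_pXn2r _ 2) ?nnegrE ?hnorm_ge0 ?(ltW d0)//.
  rewrite (le_lt_trans (rank_one_lipschitz _)) ?unitary_norm//.
  apply: (@le_lt_trans _ _ ((hnorm (rho g0 x - rho g x) * (2 * r)) ^+ 2)); last first.
    by rewrite ltr_pXn2r ?nnegrE ?(ltW d0)// mulr_ge0 ?hnorm_ge0// mulr_ge0// ltW.
  rewrite exprMn mulrC ler_wpM2l ?sqr_ge0// exprMn.
  rewrite ler_pM ?exprn_ge0 ?hnorm_ge0//; first by rewrite expr2; lra.
  by rewrite ler_pXn2r ?nnegrE ?hnorm_ge0 ?(ltW r0)// lerDl.
have taul (l : hs_preInner H) d : 0 < d ->
    \forall g \near g0, hnorm (embed (hs_map (rho g0) l) - embed (hs_map (rho g) l) : hs H) < d.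
  elim: l d => [|[a x] l IH] d d0.
    by apply: nearW => g; rewrite subrr hnorm0.
  have a0 : 0 < cabs a + 1 by rewrite ltr_wpDl ?cabs_ge0.
  have d1 : 0 < d / (2 * (cabs a + 1)) by rewrite divr_gt0// mulr_gt0.
  near=> g; rewrite !embed_hs /= !big_cons -!embed_hs -!/(hs_map _ _).
  rewrite opprD addrACA -scalerBr (le_lt_trans (Defs.hnormD _ _))// (splitr d) ltr_leD//.
    rewrite hnormZC -cabsE/=.
    have h : hnorm (rank_one (rho g0 x) - rank_one (rho g x)) < d / (2 * (cabs a + 1)).
      by near: g; exact: tau.
    apply: (@le_lt_trans _ _ ((cabs a + 1) * hnorm (rank_one (rho g0 x) - rank_one (rho g x)))).
      by rewrite ler_wpM2r ?hnorm_ge0// lerDl.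
    by rewrite mulrC -ltr_pdivlMr// (lt_le_trans h)// invfM mulrA.
  by apply: ltW; near: g; apply: IH; rewrite divr_gt0.
have e3 : 0 < e / 3 by rewrite divr_gt0.
have [l hl] := embed_dense f e3.
near=> g.
pose U := hs_unitary (rho g); pose U0 := hs_unitary (rho g0).
have -> : U0 f - U f = U0 (f - embed l) + (U0 (embed l) - U (embed l)) - U (f - embed l).
  have LB (W : unitary (hs H)) a b : W (a - b) = W a - W b by exact: linearB.
  by rewrite !LB opprB !subrKA.
rewrite (le_lt_trans (Defs.hnormD _ _))// Defs.hnormN unitary_norm.
have h : hnorm (U0 (f - embed l) + (U0 (embed l) - U (embed l))) < e / 3 + e / 3.
  rewrite (le_lt_trans (Defs.hnormD _ _))// unitary_norm ler_ltD//.
  by rewrite !hs_unitary_embed; near: g; exact: taul.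
have : hnorm (f - embed l) <= e / 3 by [].
lra.
Unshelve. all: by end_near. Qed.

Definition hs_rep (rho : Multiplicative.type G (unitary H)) (g : G) : unitary (hs H) :=
  hs_unitary (rho g).

Lemma hs_repM (rho : Multiplicative.type G (unitary H)) :
  {morph hs_rep rho : g h / (g * h)%g}.
Proof. by move=> g h; rewrite /hs_rep gmulfM hs_unitaryM. Qed.

HB.instance Definition _ (rho : Multiplicative.type G (unitary H)) :=
  isMultiplicative.Build G (unitary (hs H)) (hs_rep rho) (hs_repM rho).

End hs_rep.

(** * Almost invariant vectors *)

Lemma compact_finite_net (R : realType) (T : topologicalType) (d : T -> T -> R)
    (K : set T) (e : R) : compact K ->
  (forall x, K x -> \forall y \near x, d y x < e) ->
  exists s : seq T, forall y, K y -> exists2 x, x \in s & d y x < e.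
Proof.
move=> /compact_near_coveringP cK dK.
(* The filter of finite lists directed by inclusion: a property holds eventually if it holds for all
   lists containing some fixed one. *)
pose F := filter_from [set: seq T] (fun s : seq T => [set t : seq T | {subset s <= t}]).
have FF : Filter F.
  apply: filter_from_filter; first by exists [::].
  move=> s t _ _; exists (s ++ t) => // r sr; split=> x xs; apply: sr;
  by rewrite mem_cat xs ?orbT.
have [|s _ hs] := cK (seq T) F (fun s y => exists2 x, x \in s & d y x < e) FF.
  move=> x Kx; exists ([set y | d y x < e], [set t : seq T | x \in t]) => /=.
    split; first exact: dK.
    by exists [:: x] => // t; apply; rewrite inE.
  by move=> [y t] [/= yx xt]; exists x.
by exists s => y Ky; apply: (hs s).
Qed.

Section almost_invariant.
Context (R : realType) (H : hilbertType R).

Lemma inner_rank_one_sum m (a : 'I_m -> R) (u v : 'I_m -> H) :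
  inner (\sum_k (a k)%:C *: rank_one (v k)) (\sum_k (a k)%:C *: rank_one (u k)) =
  (\sum_k \sum_l a k * a l * normsq (inner (v k) (u l)))%:C.
Proof.
rewrite inner_suml rmorph_sum; apply: eq_bigr => k _.
rewrite inner_sumr rmorph_sum; apply: eq_bigr => l _.
rewrite innerZl innerZr inner_rank_one !rmorphM/= mulrA.
by congr (_ * _ * _); exact: conjc_real.
Qed.

Lemma orthonormal_rank_one m (u : 'I_m -> H) :
  orthonormal_family u -> orthonormal_family (fun k => rank_one (u k)).
Proof.
move=> ou i j; rewrite inner_rank_one ou.
by case: (i == j); rewrite /= ?normsq_real /normsq/= ?expr1n ?expr0n/= ?addr0.
Qed.

(** Both sums are the trace of the test operator against one operator, so they do not depend on how
    it is decomposed into rank ones. *)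
Lemma quadratic_test_sum m N (a : 'I_m -> R) (u : 'I_m -> H) (w : 'I_N -> R) (z : 'I_N -> H)
    n (e : 'I_n -> H) (s : 'I_n -> R) :
  (forall x, \sum_k a k * normsq (inner (u k) x) = \sum_j w j * normsq (inner (z j) x)) ->
  \sum_k a k * quadratic_test e s (u k) = \sum_j w j * quadratic_test e s (z j).
Proof.
move=> h; rewrite /quadratic_test.
under eq_bigr do rewrite mulr_sumr; under [RHS]eq_bigr do rewrite mulr_sumr.
rewrite exchange_big [RHS]exchange_big; apply: eq_bigr => i _.
transitivity (s i * \sum_k a k * normsq (inner (u k) (e i))).
  by rewrite mulr_sumr; apply: eq_bigr => k _; rewrite mulrCA.
by rewrite h mulr_sumr; apply: eq_bigr => k _; rewrite mulrCA.
Qed.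

(* The square root of a density operator [\sum_j w_j z_j z_j^*] is a unit vector of the
   Hilbert-Schmidt space, which moves little when the density operator does. *)
Lemma density_sqrt N (w : 'I_N -> R) (z : 'I_N -> H) :
  (forall j, 0 <= w j) -> (forall j, hnorm (z j) = 1) -> \sum_j w j = 1 ->
  exists2 f : hs H, hnorm f = 1 & forall g : unitary H,
    exists n (e : 'I_n -> H) (s : 'I_n -> R),
      [/\ orthonormal_family e, forall i, `|s i| <= 1 &
      hnorm (f - hs_unitary g f) ^+ 2 <=
      \sum_j w j * (quadratic_test e s (g (z j)) - quadratic_test e s (z j))].
Proof.
move=> w0 z1 sw; have [m [u [l [ou lE tr]]]] := finite_rank_diagonalization z w.
have {lE}lE x : \sum_k l k * normsq (inner (u k) x) = \sum_j w j * normsq (inner (z j) x).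
  by apply: complexI; rewrite -!hermitian_form_sum lE.
have l0 k : 0 <= l k.
  have := lE (u k); rewrite (bigD1 k)//= big1 => [|j jk]; last first.
    by rewrite ou (negbTE jk) normsq_real expr0n mulr0.
  rewrite ou eqxx normsq_real expr1n mulr1 addr0 => ->.
  by apply: sumr_ge0 => j _; rewrite mulr_ge0 ?normsq_ge0.
pose a k := Num.sqrt (l k).
have a0 k : 0 <= a k by exact: sqrtr_ge0.
have aE k : a k ^+ 2 = l k by rewrite sqr_sqrtr.
have sa : \sum_k a k ^+ 2 = 1.
  under eq_bigr do rewrite aE.
  by rewrite tr -[RHS]sw; apply: eq_bigr => j _; rewrite z1 expr1n mulr1.
pose f : hs H := \sum_k (a k)%:C *: rank_one (u k).
have fn : hnorm f = 1.
  apply/eqP; rewrite -(@eqrXn2 _ 2) ?hnorm_ge0// expr1n -sa; apply/eqP.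
  rewrite hnorm_sqr_orthonormal; last exact: orthonormal_rank_one.
  by apply: eq_bigr => k _; rewrite normsq_real.
exists f => // g; pose v k := g (u k).
have ov : orthonormal_family v by move=> i j; rewrite /v unitary_inner.
have [n [e [s [oe s1 ps]]]] := powers_stormer a0 ou ov.
exists n, e, s; split=> //.
have gf : hs_unitary g f = \sum_k (a k)%:C *: rank_one (v k).
  have gZ c y : hs_unitary g (c *: y) = c *: hs_unitary g y by exact: linearZ_LR.
  have -> : hs_unitary g f = \sum_k hs_unitary g ((a k)%:C *: rank_one (u k)).
    exact: linear_sum.
  by apply: eq_bigr => k _; rewrite gZ hs_unitary_rank_one.
rewrite Defs.hnormB hnorm_sqrB unitary_norm fn gf inner_rank_one_sum /= expr1n.
(* As the [a k ^+ 2] sum to 1, this is exactly the squared distance between the two square roots. *)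
apply: (@le_trans _ _ (2 * (\sum_k a k ^+ 2) -
    2 * (\sum_k \sum_l a k * a l * normsq (inner (v k) (u l))))).
  by rewrite sa; lra.
apply: (le_trans ps); under [leLHS]eq_bigr do rewrite aE mulrBr.
under [leRHS]eq_bigr do rewrite mulrBr.
rewrite !sumrB (quadratic_test_sum e s lE) lerD2r.
rewrite (@quadratic_test_sum _ _ l v w (fun j => g (z j)))// => x.
have ga y : inner (g y) x = inner y ((g^-1)%g x) by exact: unitary_adjoint.
under eq_bigr do rewrite ga; under [RHS]eq_bigr do rewrite ga.
exact: lE.
Qed.

Context (G : topologicalGroupType) (rho : Multiplicative.type G (unitary H)).
Hypothesis rho_cont : forall g (e : R), 0 < e ->
  \forall h \near g, unitary_dist (rho h) (rho g) < e.

Lemma unitary_dist_ge0 (u v : unitary H) : 0 <= unitary_dist u v.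
Proof.
have := @unitary_dist_ub _ _ u v 0; rewrite hnorm0 => /(_ ler01).
exact: le_trans (hnorm_ge0 _).
Qed.

(** The vector is the square root of the density operator that puts the weights of Reiter's
    condition on the orbit points [rho (h j) x0]. A compact set is replaced by a finite net, since
    Reiter's condition concerns finitely many group elements. *)
Lemma hs_almost_invariant (xi : H) : xi != 0 -> amenable R G ->
  almost_invariant_vectors (hs_rep rho).
Proof.
move=> xi0 amG e K e0 cK.
have nxi : hnorm xi != 0 by apply: contra_neq xi0; exact: hnorm_eq0.
pose x0 : H := ((hnorm xi)^-1)%:C *: xi.
have x01 : hnorm x0 = 1.
  by rewrite hnormZ ger0_norm ?invr_ge0 ?hnorm_ge0// mulVf.
pose d g h := unitary_dist (rho g) (rho h).
(* Replacing [g] by a point of the net costs [2 dl = e^2 / 4], and Reiter's condition is used with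
   [e^2 / 2]; together they stay below [e^2]. *)
pose dl := e ^+ 2 / 8; have dl0 : 0 < dl by rewrite divr_gt0// exprn_gt0.
have [s hs] : exists s : seq G, forall y, K y -> exists2 x, x \in s & d y x < dl.
  by apply: compact_finite_net cK _ => x _; exact: rho_cont.
have d_refl g : d g g = 0 by exact: unitary_distxx.
have d_ge0 g h : 0 <= d g h by exact: unitary_dist_ge0.
have d_mulr h h' k : d (h * k)%g (h' * k)%g <= d h h'.
  rewrite /d !gmulfM (le_trans (unitary_dist_mul _ _ _ _))//.
  by rewrite unitary_distxx addr0.
have d_mull h k k' : d (h * k)%g (h * k')%g <= d k k'.
  rewrite /d !gmulfM (le_trans (unitary_dist_mul _ _ _ _))//.
  by rewrite unitary_distxx add0r.
pose gam (i : 'I_(size s)) := nth 1%g s i.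
have e20 : 0 < e ^+ 2 / 2 by rewrite divr_gt0// exprn_gt0.
have [m [h [w [w0 w1 hw]]]] := @reiter R G d d_ge0 d_mulr d_mull rho_cont _ gam _ amG e20.
have [f f1 hf] := @density_sqrt m w (fun j => rho (h j) x0) w0
  (fun j => etrans (unitary_norm _ _) x01) w1.
exists f => [|g Kg]; first by rewrite hnormE f1.
rewrite hnormE ltcR -(@ltr_pXn2r _ 2) ?nnegrE ?hnorm_ge0 ?(ltW e0)//.
have [n [b [sg [ob s1 hfg]]]] := hf (rho g).
apply: (le_lt_trans hfg); pose q := quadratic_test b sg.
have q1 y : hnorm y = 1 -> `|q y| <= 1.
  by move=> y1; rewrite (le_trans (quadratic_test_bound _ ob s1))// y1 expr1n.
have qd k k' : `|q (rho k x0) - q (rho k' x0)| <= 2 * d k k'.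
  rewrite (le_trans (quadratic_test_lipschitz _ _ ob s1))// mulrC.
  rewrite ler_pM ?hnorm_ge0//; last by rewrite unitary_dist_ub// x01.
  by rewrite (le_trans (Defs.hnormD _ _))// !unitary_norm x01.
have [k ks gk] := hs _ Kg; pose i0 := Ordinal (etrans (index_mem k s) ks).
have gam_i0 : gam i0 = k by rewrite /gam nth_index.
(* The test depends on [g], which is allowed because the weights work for all Lipschitz functions.
   Only the copy of the net point [k] is nonzero, so the drift reduces to that of [k]. *)
pose x (p : 'I_(size s) * G) : R := if p.1 == i0 then q (rho p.2 x0) else 0.
have Lx : lipschitz_ball d x.
  split=> [[i y]|i y y']; rewrite /x /=; case: ifP => _; rewrite ?normr0//.
  - by rewrite q1// unitary_norm.
  - by rewrite subrr normr0 mulr_ge0.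
have dx y : drift gam x y = q (rho (k * y)%g x0) - q (rho y x0).
  rewrite /drift (bigD1 i0)//= big1 => [|i ii0]; rewrite /x /= ?eqxx ?(negbTE ii0) ?subrr//.
  by rewrite addr0 gam_i0.
apply: (@le_lt_trans _ _ (\sum_j w j * (drift gam x (h j) + 2 * d g k))).
  apply: ler_sum => j _; rewrite ler_wpM2l// dx addrAC lerD2r.
  have := qd (g * h j)%g (k * h j)%g; rewrite ler_norml => /andP[_].
  rewrite gmulfM unitaryM => hq; have := d_mulr g k (h j); rewrite -/q; lra.
under eq_bigr do rewrite mulrDr; rewrite big_split/= -mulr_suml w1 mul1r.
have := hw _ Lx; rewrite /dl in gk; lra.
Qed.

End almost_invariant.

(** * Maximizers of compact quadratic forms *)

(** By compactness of [[-C, C]], [phi] has a cluster value [c] along [U]. The set where [phi] is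
    within [e / 2] of [c] belongs to [U], since otherwise its complement would, against
    clustering. *)
Lemma ultra_oscillation (R : realType) (T : Type) (U : set_system T) (phi : T -> R) (C e : R) :
  UltraFilter U -> U [set x | `|phi x| <= C] -> 0 < e ->
  exists2 A, U A & forall x y, A x -> A y -> `|phi x - phi y| < e.
Proof.
move=> UU UC e0; have e2 : 0 < e / 2 by rewrite divr_gt0.
have [|c [_ cc]] := @segment_compact R (- C) C (phi @ U) _.
  change (U (phi @^-1` `[- C, C])).
  by apply: filterS UC => x /=; rewrite in_itv/= -ler_norml.
pose A := [set x | `|c - phi x| < e / 2].
have [UA|UA] := in_ultra_setVsetC A UU.
  exists A => // x y; rewrite /A/= => cx cy.
  by rewrite -(subrKA c) (le_lt_trans (ler_normD _ _))// (splitr e) ltrD// distrC.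
have [] := cc (phi @` (~` A)) (ball c (e / 2)).
- change (U (phi @^-1` (phi @` ~` A))).
  by apply: filterS UA => x Ax; exists x.
- exact: nbhsx_ballx.
by move=> _ [[x /= Ax <-]] xb; have /Ax := xb.
Qed.

Section quadratic_form.
Context (R : realType) (H : hilbertType R) (q : H -> R).
Hypothesis qZ : forall a x, q (a *: x) = normsq a * q x.
Hypothesis qP : forall x y, q (x + y) + q (x - y) = 2 * (q x + q y).
Hypothesis q_bounded : exists C, forall x, `|q x| <= C * hnorm x ^+ 2.
(* satisfied by the form of a compact operator *)
Hypothesis q_compact : forall e, 0 < e -> exists2 l : seq (R * H),
  (forall p, p \in l -> 0 <= p.1) &
  forall x, q x <= e * hnorm x ^+ 2 + \sum_(p <- l) p.1 * normsq (inner p.2 x).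
Hypothesis q_gt0 : exists x, 0 < q x.

Definition qmax : R := sup [set q x | x in [set x | hnorm x <= 1]].

Lemma qmax_has_sup : has_sup [set q x | x in [set x | hnorm x <= 1]].
Proof.
split; first by exists (q 0), 0 => //=; rewrite hnorm0.
have [C hC] := q_bounded; exists (Num.max C 0) => _ [x /= x1 <-].
rewrite (le_trans (ler_norm _))// (le_trans (hC x))//.
rewrite (@le_trans _ _ (Num.max C 0 * hnorm x ^+ 2))//.
  by rewrite ler_wpM2r ?sqr_ge0// le_max lexx.
by rewrite ler_piMr// ?le_max ?lexx ?orbT// exprn_ile1 ?hnorm_ge0.
Qed.

Lemma q_le_qmax x : q x <= qmax * hnorm x ^+ 2.
Proof.
have [->|x0] := eqVneq x 0.
  rewrite hnorm0 expr0n mulr0 -(scale0r (0 : H)) qZ /normsq/= !expr0n/=.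
  by rewrite addr0 mul0r.
have nx : 0 < hnorm x.
  by rewrite lt_neqAle hnorm_ge0 andbT eq_sym; apply: contra_neq x0; exact: hnorm_eq0.
have : q (((hnorm x)^-1)%:C *: x) <= qmax.
  apply: sup_upper_bound; first exact: qmax_has_sup.
  exists (((hnorm x)^-1)%:C *: x) => //=.
  by rewrite hnormZ ger0_norm ?invr_ge0 ?hnorm_ge0// mulVf// gt_eqF.
by rewrite qZ normsq_real exprVn mulrC ler_pdivrMr// exprn_gt0.
Qed.

Lemma qmax_gt0 : 0 < qmax.
Proof.
have [x qx] := q_gt0; rewrite ltNge; apply/negP => m0.
have := lt_le_trans qx (q_le_qmax x); rewrite ltNge => /negP; apply.
by rewrite mulr_le0_ge0 ?sqr_ge0.
Qed.

(** The form of [qmax - T], where [T] is the operator of [q]. Only its nonnegativity, homogeneity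
    and parallelogram law are used, so [T] itself is never constructed. *)
Definition defect x := qmax * hnorm x ^+ 2 - q x.

Lemma defect_ge0 x : 0 <= defect x.
Proof. by rewrite subr_ge0 q_le_qmax. Qed.

Lemma defect_parallelogram x y :
  defect (x + y) + defect (x - y) = 2 * (defect x + defect y).
Proof.
have := qP x y; have := hnorm_parallelogram x y; rewrite /defect => h1 h2.
rewrite addrACA -mulrDr h1 -opprD h2; ring.
Qed.

Lemma defect_add_le x y : defect (x + y) <= 2 * (defect x + defect y).
Proof. by rewrite -defect_parallelogram lerDl defect_ge0. Qed.

Lemma defect_sub_le x y : defect (x - y) <= 2 * (defect x + defect y).
Proof. by rewrite -defect_parallelogram lerDr defect_ge0. Qed.

Lemma defectZ a x : defect (a *: x) = normsq a * defect x.
Proof. by rewrite /defect hnorm_sqrZ qZ; ring. Qed.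

Lemma defect_bounded : exists2 C, 0 < C & forall x, defect x <= C * hnorm x ^+ 2.
Proof.
have [C hC] := q_bounded; exists (qmax + Num.max C 1).
  by rewrite addr_gt0 ?qmax_gt0// lt_max ltr01 orbT.
move=> x; rewrite /defect mulrDl lerD2l lerNl (le_trans _ (lerNnormlW (hC x)))// lerN2.
by rewrite ler_wpM2r ?sqr_ge0// le_max lexx.
Qed.

(** The top eigenspace. It is a linear subspace because, by the parallelogram law, a nonnegative
    form vanishing at [x] and [y] vanishes at [x + y]. *)
Definition maximizer : set H := [set x | defect x = 0].

Lemma maximizerP x : maximizer x <-> defect x <= 0.
Proof.
rewrite /maximizer/=; split=> [->//|h].
by apply/eqP; rewrite eq_le h defect_ge0.
Qed.

Lemma maximizer_linear a x y : maximizer x -> maximizer y -> maximizer (a *: x + y).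
Proof.
move=> hx hy; apply/maximizerP; apply: (le_trans (defect_add_le _ _)).
by rewrite defectZ hx hy mulr0 addr0 mulr0.
Qed.

Lemma maximizer0 : maximizer 0.
Proof. by apply/maximizerP; rewrite -(scale0r (0 : H)) defectZ /normsq/= expr0n addr0 mul0r. Qed.

Lemma maximizer_closed x :
  (forall e, 0 < e -> exists2 y, maximizer y & hnorm (x - y) <= e) -> maximizer x.
Proof.
move=> h; apply/maximizerP; have [C C0 hC] := defect_bounded.
apply: (@real_small_le _ _ _ (2 * C)) => e e0; rewrite add0r.
pose d := Num.min e 1; have d0 : 0 < d by rewrite lt_min e0 ltr01.
have d1 : d <= 1 by rewrite ge_min lexx orbT.
have [y hy xy] := h d d0; rewrite -(subrK y x) (le_trans (defect_add_le _ _))// hy addr0 -mulrA.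
rewrite ler_wpM2l// (le_trans (hC _))// ler_wpM2l ?(ltW C0)//.
rewrite (@le_trans _ _ (d ^+ 2))//; first by rewrite ler_pXn2r ?nnegrE ?hnorm_ge0 ?(ltW d0)//.
by rewrite expr2 (@le_trans _ _ d)// ?ler_piMr ?(ltW d0)// ge_min lexx.
Qed.

(** Compactness at level [qmax / 2] leaves at least [qmax / 2] to the finite sum at each [e i].
    Summing over [i], Bessel's inequality bounds the total independently of [n]. *)
Lemma maximizer_dim : exists B : nat, forall n (e : 'I_n -> H), orthonormal_family e ->
  (forall i, maximizer (e i)) -> (n <= B)%N.
Proof.
have m2 : 0 < qmax / 2 by rewrite divr_gt0// qmax_gt0.
have [l l0 hl] := q_compact m2.
pose S := \sum_(p <- l) p.1 * hnorm p.2 ^+ 2.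
exists (Num.truncn (S / (qmax / 2))) => n e oe he.
have S0 : 0 <= S by rewrite /S big_seq sumr_ge0// => p /l0 p0; rewrite mulr_ge0 ?sqr_ge0.
have Sm : 0 <= S / (qmax / 2) by apply: divr_ge0 => //; exact: ltW.
rewrite truncn_ge_nat// ler_pdivlMr//.
have h1 i : qmax / 2 <= \sum_(p <- l) p.1 * normsq (inner p.2 (e i)).
  have := he i; have := hl (e i); rewrite /maximizer/= /defect (orthonormal_hnorm _ oe) expr1n; lra.
have : \sum_(i < n) (qmax / 2) <= \sum_i \sum_(p <- l) p.1 * normsq (inner p.2 (e i)).
  by apply: ler_sum => i _; exact: h1.
rewrite sumr_const card_ord -[qmax / 2 *+ n]mulr_natl => h; apply: (le_trans h).
rewrite exchange_big /S big_seq [leRHS]big_seq; apply: ler_sum => p /l0 p0.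
by rewrite -mulr_sumr ler_wpM2l// bessel.
Qed.

(** An orthonormal family of maximal size spans: a vector outside its span would extend it without
    leaving the subspace. *)
Lemma maximizer_finite : exists n (e : 'I_n -> H), [/\ orthonormal_family e,
  forall i, maximizer (e i) & forall x, maximizer x -> x = projection e x].
Proof.
have [B hB] := maximizer_dim.
pose P n := `[< exists e : 'I_n -> H, orthonormal_family e /\ forall i, maximizer (e i) >].
have P0 : exists n, P n by exists 0%N; apply/asboolP; exists (fun=> 0); split=> -[].
have PB n : P n -> (n <= B)%N by move=> /asboolP[e [oe he]]; exact: hB oe he.
case: (ex_maxnP P0 PB) => n /asboolP[e [oe he]] nmax; exists n, e; split=> // x hx.
apply: contrapT => /(orthonormal_extend oe)[e' [oe' e'e [a e'a]]].
have /nmax : P n.+1; last by rewrite ltnn.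
apply/asboolP; exists e'; split=> // i.
have hproj : maximizer (projection e x).
  rewrite /projection; elim/big_ind : _ => [|y z hy hz|j _].
  - exact: maximizer0.
  - by rewrite -[y]scale1r; exact: maximizer_linear.
  - by rewrite -[_ *: _]addr0; apply: maximizer_linear => //; exact: maximizer0.
case: (unliftP ord_max i) => [j ->|->]; first by rewrite e'e.
rewrite e'a -[_ *: _]addr0; apply: maximizer_linear; last exact: maximizer0.
by rewrite addrC -scaleN1r; exact: maximizer_linear.
Qed.

(** Stands in for weak compactness of the unit ball: along an ultrafilter, each of the finitely many
    functionals [<p.2, x>] has small oscillation. *)
Lemma ultra_inner_small (U : set_system H) (l : seq (R * H)) (e : R) : UltraFilter U ->
  U [set x | hnorm x <= 1] -> (forall p, p \in l -> 0 <= p.1) -> 0 < e ->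
  exists2 A, U A &
    forall x y, A x -> A y -> \sum_(p <- l) p.1 * normsq (inner p.2 (x - y)) < e.
Proof.
move=> UU U1; elim: l e => [|p l IH] e l0 e0.
  by exists setT; [exact: filterT|move=> x y _ _; rewrite big_nil].
have [|A UA hA] := IH (e / 2) _ (divr_gt0 e0 (ltr0n R 2)).
  by move=> r rl; apply: l0; rewrite inE rl orbT.
have p0 : 0 <= p.1 by apply: l0; rewrite inE eqxx.
(* The real and imaginary parts contribute at most [d] each, hence [(p.1 + 1) 2 d = e / 2] for this
   term; the 1 avoids a division by 0. *)
pose d := e / (4 * (p.1 + 1)).
have d0 : 0 < d by rewrite divr_gt0// mulr_gt0// ltr_wpDl.
have bnd (phi : R[i] -> R) : (forall z, `|phi z| <= cabs z) ->
    U [set x | `|phi (inner p.2 x)| <= hnorm p.2].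
  move=> hphi; apply: filterS U1 => x /= x1; rewrite (le_trans (hphi _))//.
  rewrite -(@ler_pXn2r _ 2) ?nnegrE ?cabs_ge0 ?hnorm_ge0// cabs_sqr.
  rewrite (le_trans (normsq_inner_le _ _))// ler_piMr ?sqr_ge0//.
  by rewrite exprn_ile1 ?hnorm_ge0.
have s0 : 0 < Num.sqrt d by rewrite sqrtr_gt0.
have [A1 UA1 h1] := ultra_oscillation UU (bnd _ (@Re_le_cabs R)) s0.
have [A2 UA2 h2] := ultra_oscillation UU (bnd _ (@Im_le_cabs R)) s0.
exists (A `&` (A1 `&` A2)); first by apply: filterI => //; exact: filterI.
move=> x y [Ax [A1x A2x]] [Ay [A1y A2y]]; rewrite big_cons.
have sq (t : R) : `|t| < Num.sqrt d -> t ^+ 2 < d.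
  by move=> td; rewrite -(sqr_sqrtr (ltW d0)) -real_normK ?num_real// ltr_pXn2r ?nnegrE// ltW.
have hn : normsq (inner p.2 (x - y)) <= 2 * d.
  rewrite innerBr /normsq !raddfB/= mulr_natl mulr2n; apply: lerD; apply/ltW/sq.
    exact: h1.
  exact: h2.
have : p.1 * normsq (inner p.2 (x - y)) <= e / 2.
  apply: (@le_trans _ _ ((p.1 + 1) * (2 * d))).
    by rewrite ler_pM ?normsq_ge0// lerDl.
  by rewrite (_ : _ * (2 * d) = e / 2)// /d; field; rewrite gt_eqF// ltr_wpDl.
by move=> h; rewrite (splitr e) ler_ltD// hA.
Qed.

(* Approximate maximizers in the unit ball form a Cauchy filter: by the parallelogram law the
   defect of a difference is small, and compactness of [q] makes [q] itself small on differences. *)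
Lemma maximizer_neq0 : exists2 x, maximizer x & x != 0.
Proof.
pose B e : set H := [set x | hnorm x <= 1 /\ qmax - e < q x].
have m0 := qmax_gt0.
have BF : ProperFilter (filter_from [set e : R | 0 < e] B).
  apply: filter_from_proper; first apply: filter_from_filter.
  - by exists 1 => /=.
  - move=> d e d0 e0; exists (Num.min d e) => /=; first by rewrite lt_min d0 e0.
    move=> x [x1 qx]; split; split=> //; apply: le_lt_trans qx; rewrite lerB// ge_min lexx ?orbT//.
  move=> e e0; have [_ [x /= x1 <-] qx] := sup_adherent e0 qmax_has_sup.
  by exists x.
have [U [UU UB]] := ultraFilterLemma BF.
have UBe e : 0 < e -> U (B e) by move=> e0; apply: UB; exists e.
have def e x : B e x -> defect x <= e.
  move=> [x1 qx]; rewrite /defect.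
  have : qmax * hnorm x ^+ 2 <= qmax by rewrite ler_piMr ?(ltW m0)// exprn_ile1 ?hnorm_ge0.
  lra.
have U1 : U [set x | hnorm x <= 1] by apply: filterS (UBe 1 ltr01) => x [].
have small e : 0 < e -> exists2 A, U A & forall x y, A x -> A y -> hnorm (x - y) < e.
  (* The defect of [x - y] is at most [4 d] and [q (x - y)] is below [4 d + d], so [qmax |x - y|^2]
     stays below [9 d < 16 d = qmax e^2]. *)
  move=> e0; pose d := qmax * e ^+ 2 / 16.
  have d0 : 0 < d by rewrite divr_gt0// mulr_gt0// exprn_gt0.
  have [l l0 hl] := q_compact d0.
  have [A UA hA] := ultra_inner_small UU U1 l0 d0.
  exists (A `&` B d); first by apply: filterI => //; exact: UBe.
  move=> x y [Ax Bx] [Ay By]; rewrite -(@ltr_pXn2r _ 2) ?nnegrE ?hnorm_ge0 ?(ltW e0)//.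
  have h1 := defect_sub_le x y; have h2 := def _ _ Bx; have h3 := def _ _ By.
  have h4 := hl (x - y); have h5 := hA _ _ Ax Ay.
  have h6 : hnorm (x - y) ^+ 2 <= 4.
    have := hnorm_parallelogram x y; have := sqr_ge0 (hnorm (x + y)).
    have xx : hnorm x ^+ 2 <= 1 by rewrite exprn_ile1 ?hnorm_ge0//; case: Bx.
    have yy : hnorm y ^+ 2 <= 1 by rewrite exprn_ile1 ?hnorm_ge0//; case: By.
    lra.
  have h7 : d * hnorm (x - y) ^+ 2 <= d * 4 by rewrite ler_wpM2l// ltW.
  rewrite -(ltr_pM2l m0).
  have h8 : defect (x - y) = qmax * hnorm (x - y) ^+ 2 - q (x - y) by [].
  have : d * 16 = qmax * e ^+ 2 by rewrite /d divfK.
  lra.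
have Uc : cauchy U.
  apply/cauchyP => e e0; have er : e = (complex.Re e)%:C by rewrite RRe_real// gtr0_real.
  rewrite er ltcR in e0; have [A UA hA] := small _ e0.
  have [x Ax] := filter_ex UA; exists x; apply: filterS UA => y Ay.
  by rewrite -ball_normE /= hnormE er ltcR hA.
have /cvg_ex[x Ux] : cvg U by exact: cauchy_cvg.
have near_x e : 0 < e -> U [set y | hnorm (x - y) < e].
  move=> e0; have /cvgrPdist_lt/(_ e%:C) := Ux; rewrite ltcR => /(_ e0).
  by apply: filterS => y; rewrite /= hnormE ltcR.
have [C C0 hC] := defect_bounded.
exists x.
  apply/maximizerP; apply: (@real_small_le _ _ _ (2 * C + 2)) => e e0; rewrite add0r.
  pose d := Num.min e 1; have d0 : 0 < d by rewrite lt_min e0 ltr01.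
  have d1 : d <= 1 by rewrite ge_min lexx orbT.
  have [y [/= xy By]] := filter_ex (filterI (near_x _ d0) (UBe _ e0)).
  rewrite -(subrK y x) (le_trans (defect_add_le _ _))//.
  have h : hnorm (x - y) ^+ 2 <= e.
    rewrite (@le_trans _ _ (d ^+ 2))//.
      by rewrite ler_pXn2r ?nnegrE ?hnorm_ge0 ?(ltW d0) ?(ltW xy).
    by rewrite expr2 (@le_trans _ _ d)// ?ler_piMr ?(ltW d0)// ge_min lexx.
  have := hC (x - y); have := def _ _ By.
  have : C * hnorm (x - y) ^+ 2 <= C * e by rewrite ler_wpM2l// ltW.
  lra.
(* If the limit were 0, there would be a vector of norm below 1/2 with [q] above [qmax / 2], which
   the bound by [qmax] forbids. *)
apply/eqP => x0; have m2 : 0 < qmax / 2 by rewrite divr_gt0.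
have h2 : 0 < 1 / 2 :> R by rewrite divr_gt0.
have [y [/= xy [_ qy]]] := filter_ex (filterI (near_x _ h2) (UBe _ m2)).
rewrite x0 sub0r Defs.hnormN in xy.
have hy : hnorm y ^+ 2 <= 1 / 2.
  rewrite expr2 (@le_trans _ _ (hnorm y * 1))//; last by rewrite mulr1 ltW.
  by rewrite ler_wpM2l ?hnorm_ge0//; move: xy; lra.
have := q_le_qmax y; have : qmax * hnorm y ^+ 2 <= qmax * (1 / 2) by rewrite ler_wpM2l// ltW.
lra.
Qed.

End quadratic_form.

(** * Subrepresentations *)

Lemma hilbert_cauchy_converges (R : realType) (H : hilbertType R) (u : nat -> H) :
  (forall e : R, 0 < e -> exists N, forall m n, (N <= m)%N -> (N <= n)%N ->
    hnorm (u m - u n) <= e) ->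
  exists x, forall e : R, 0 < e -> exists N, forall n, (N <= n)%N -> hnorm (u n - x) <= e.
Proof.
move=> uc; have : cvgn u.
  apply/cauchy_cvgP/cauchyP => e e0.
  have er : e = (complex.Re e)%:C by rewrite RRe_real// gtr0_real.
  rewrite er ltcR in e0; have [N hN] := uc _ (divr_gt0 e0 (ltr0n R 2)).
  exists (u N); exists N => // n Nn; rewrite -ball_normE /= hnormE er ltcR.
  by rewrite (le_lt_trans (hN _ _ (leqnn N) Nn))// ltr_pdivrMr// mulr_natr mulr2n ltrDl.
move=> /cvg_ex[x ux]; exists x => e e0.
have /cvgrPdist_le/(_ e%:C) := ux; rewrite ltcR => /(_ e0)[N _ hN]; exists N => n Nn.
by rewrite Defs.hnormB -lecR -hnormE; exact: hN.
Qed.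

Record closedSubspace (R : realType) (H : hilbertType R) := ClosedSubspace {
  cs_set : set H;
  cs_set0 : cs_set 0;
  cs_linear : forall a x y, cs_set x -> cs_set y -> cs_set (a *: x + y);
  cs_closed : forall x, (forall e : R, 0 < e -> exists2 y, cs_set y & hnorm (x - y) <= e) ->
    cs_set x }.

Lemma multiplicative1 (G K : groupType) (f : Multiplicative.type G K) : f 1%g = 1%g.
Proof. by apply: (mulgI (f 1%g)); rewrite -gmulfM !mulg1. Qed.

Section subspace.
Context (R : realType) (H : hilbertType R) (V : closedSubspace H).

Definition cs_pred : {pred H} := [pred x | `[< cs_set V x >]].

Lemma cs_submod : submod_closed cs_pred.
Proof.
split=> [|a x y /asboolP Vx /asboolP Vy]; apply/asboolP; first exact: cs_set0.
exact: cs_linear.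
Qed.

HB.instance Definition _ := GRing.isSubmodClosed.Build R[i] H cs_pred cs_submod.

Definition cs_type := {x : H | x \in cs_pred}.
HB.instance Definition _ := [isSub of cs_type for sval].
HB.instance Definition _ := [Choice of cs_type by <:].
HB.instance Definition _ := [SubChoice_isSubLmodule of cs_type by <:].

Lemma cs_val (x : cs_type) : cs_set V (val x).
Proof. by have /asboolP := valP x. Qed.

Definition cs_elt x (Vx : cs_set V x) : cs_type := exist (fun y => y \in cs_pred) x (asboolT Vx).

Definition cs_form (x y : cs_type) := inner (val x) (val y).

Lemma cs_form_linear z : scalar (cs_form ^~ z).
Proof.
move=> a x y; rewrite /cs_form (_ : val (a *: x + y) = a *: val x + val y)//.
by rewrite innerDl innerZl.
Qed.

Lemma cs_form_conj x y : cs_form x y = (cs_form y x)^*.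
Proof. exact: innerC. Qed.

Lemma cs_form_gt0 x : x != 0 -> 0 < cs_form x x.
Proof.
move=> x0; rewrite /cs_form innerxx ltcR exprn_gt0// lt_neqAle hnorm_ge0 andbT eq_sym.
by apply: contra_neq x0 => /hnorm_eq0 h; exact: val_inj.
Qed.

Lemma cs_form_complete (u : nat -> cs_type) :
  (forall e : R, 0 < e -> exists N, forall m n, (N <= m)%N -> (N <= n)%N ->
      cs_form (u m - u n) (u m - u n) <= e%:C) ->
  exists x, forall e : R, 0 < e -> exists N, forall n, (N <= n)%N ->
      cs_form (u n - x) (u n - x) <= e%:C.
Proof.
have fE x y : cs_form (x - y) (x - y) = (hnorm (val x - val y) ^+ 2)%:C.
  by rewrite /cs_form (_ : val (x - y) = val x - val y)// innerxx.
move=> uc; have [|x hx] := @hilbert_cauchy_converges R H (fun n => val (u n)).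
  move=> e e0; have [N hN] := uc _ (exprn_gt0 2 e0); exists N => m n Nm Nn.
  rewrite -(@ler_pXn2r _ 2) ?nnegrE ?hnorm_ge0 ?(ltW e0)// -lecR -fE; exact: hN.
have Vx : cs_set V x.
  apply: cs_closed => e /hx[N /(_ N (leqnn N)) hN]; exists (val (u N)); first exact: cs_val.
  by rewrite Defs.hnormB.
exists (cs_elt Vx) => e e0; have s0 : 0 < Num.sqrt e by rewrite sqrtr_gt0.
have [N hN] := hx _ s0; exists N => n Nn.
rewrite fE lecR -[e](sqr_sqrtr (ltW e0)) ler_pXn2r ?nnegrE ?hnorm_ge0 ?(ltW s0)//.
exact: hN.
Qed.

Definition cs_ips : innerProductSpace R := @InnerProductSpace R cs_type cs_form
  cs_form_linear cs_form_conj cs_form_gt0 cs_form_complete.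

Definition cs_hilbert : hilbertType R := ipsT cs_ips.

Lemma cs_hnorm (x : cs_hilbert) : hnorm x = hnorm (val x).
Proof.
apply/eqP; rewrite -(@eqrXn2 _ 2) ?hnorm_ge0//; apply/eqP/complexI.
by rewrite -!innerxx.
Qed.

Section restriction.
Context (G : topologicalGroupType) (rho : Multiplicative.type G (unitary H)).
Hypothesis inv : forall g x, cs_set V x -> cs_set V (rho g x).

Definition restrict_fun g (x : cs_hilbert) : cs_hilbert := cs_elt (inv g (cs_val x)).

Lemma restrict_unitary g : Defs.is_unitary (restrict_fun g).
Proof.
split=> [a x y|x y|y].
- by apply: val_inj; rewrite [LHS]/= linearP [RHS]linearP.
- exact: unitary_inner.
- exists (restrict_fun (g^-1)%g y); apply: val_inj.
  by rewrite /= -unitaryM -gmulfM mulgV multiplicative1.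
Qed.

Definition restrict_rep g : unitary cs_hilbert := Unitary (restrict_unitary g).

Lemma restrict_repM : {morph restrict_rep : g h / (g * h)%g}.
Proof.
by move=> g h; apply: unitary_eq => x; apply: val_inj; rewrite /= gmulfM.
Qed.

HB.instance Definition _ := isMultiplicative.Build G (unitary cs_hilbert) restrict_rep
  restrict_repM.

Lemma restrict_dist g h : unitary_dist (restrict_rep g) (restrict_rep h) <=
  unitary_dist (rho g) (rho h).
Proof.
apply: unitary_dist_le => x; rewrite !cs_hnorm => x1.
by rewrite (_ : val _ = rho g (val x) - rho h (val x))// unitary_dist_ub.
Qed.

Lemma restrict_strongly_continuous :
  strongly_continuous rho -> strongly_continuous restrict_rep.
Proof.
move=> crho x; apply/continuous_hnormP => g e e0.
have /continuous_hnormP/(_ g e e0) := crho (val x); apply: filterS => h.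
by rewrite cs_hnorm.
Qed.

End restriction.

End subspace.

(** * The invariant subspace *)

Lemma ReD (R : realType) (a b : R[i]) : complex.Re (a + b) = complex.Re a + complex.Re b.
Proof. by case: a b => [? ?] [? ?]. Qed.

Lemma normsq_parallelogram (R : realType) (a b : R[i]) :
  normsq (a + b) + normsq (a - b) = 2 * (normsq a + normsq b).
Proof. by case: a b => [a a'] [b b']; rewrite /normsq/=; ring. Qed.

Section hs_quadratic_form.
Context (R : realType) (H : hilbertType R) (f : hs H).

(** The form [Re <f x, x>] of the hermitian part of [f]. *)
Definition hs_quadratic (x : H) : R := complex.Re (inner f (rank_one x)).

Lemma rank_oneZ a (x : H) : rank_one (a *: x) = (normsq a)%:C *: rank_one x.
Proof.
apply: val_inj; apply/funext => v.
rewrite -[LHS]/(hs_form [:: (1, a *: x)] v) -[RHS]/((normsq a)%:C * hs_form [:: (1, x)] v).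
rewrite /hs_form !big_seq1 mulr_sumr; apply: eq_bigr => p _ /=.
by rewrite innerZl normsqM rmorphM/=; ring.
Qed.

Lemma rank_one_parallelogram (x y : H) :
  rank_one (x + y) + rank_one (x - y) = (2 : R[i]) *: (rank_one x + rank_one y).
Proof.
apply: val_inj; apply/funext => v.
rewrite -[LHS]/(hs_form [:: (1, x + y)] v + hs_form [:: (1, x - y)] v).
rewrite -[RHS]/(2 * (hs_form [:: (1, x)] v + hs_form [:: (1, y)] v)).
rewrite /hs_form !big_seq1 -!big_split/= mulr_sumr; apply: eq_bigr => p _.
rewrite innerDl innerBl -!mulrDr mulrCA; congr (_ * _).
rewrite -!rmorphD/= normsq_parallelogram rmorphM/=; congr (_ * _).
exact: rmorph_nat.
Qed.

Lemma hnorm_rank_one (x : H) : hnorm (rank_one x) = hnorm x ^+ 2.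
Proof.
apply/eqP; rewrite -(@eqrXn2 _ 2) ?hnorm_ge0 ?sqr_ge0//; apply/eqP/complexI.
by rewrite -innerxx inner_rank_one innerxx normsq_real.
Qed.

Lemma hs_quadraticZ a x : hs_quadratic (a *: x) = normsq a * hs_quadratic x.
Proof.
rewrite /hs_quadratic rank_oneZ innerZr -[_^*]/((_%:C)^*)%C conjc_real.
by case: (inner _ _) => u v; simpc.
Qed.

Lemma hs_quadratic_parallelogram x y : hs_quadratic (x + y) + hs_quadratic (x - y) =
  2 * (hs_quadratic x + hs_quadratic y).
Proof.
rewrite /hs_quadratic -!ReD -!innerDr rank_one_parallelogram innerZr.
rewrite (_ : 2^* = (2 : R)%:C); last by rewrite !rmorph_nat.
by case: (inner _ _) => u v; simpc.
Qed.

Lemma hs_quadratic_bounded : exists C, forall x, `|hs_quadratic x| <= C * hnorm x ^+ 2.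
Proof.
exists (hnorm f) => x; rewrite -hnorm_rank_one ler_norml; apply/andP; split.
  rewrite lerNl (_ : - _ = complex.Re (inner (- f) (rank_one x))).
    by rewrite (le_trans (Re_inner_le _ _))// Defs.hnormN.
  rewrite -[- f]scaleN1r innerZl mulN1r /hs_quadratic.
  by case: (inner _ _).
exact: Re_inner_le.
Qed.

(** A finite list approximates [f] to within [e], and [x x^*] has norm [|x|^2]. In the remaining
    finite sum the complex coefficients are bounded by their moduli. *)
Lemma hs_quadratic_compact e : 0 < e -> exists2 l : seq (R * H),
  (forall p, p \in l -> 0 <= p.1) &
  forall x, hs_quadratic x <= e * hnorm x ^+ 2 + \sum_(p <- l) p.1 * normsq (inner p.2 x).
Proof.
move=> e0; have [l hl] := embed_dense f e0; exists [seq (cabs p.1, p.2) | p <- l].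
  by move=> _ /mapP[p _ ->]; exact: cabs_ge0.
move=> x; rewrite /hs_quadratic -[f](subrK (embed l : hs H)) innerDl ReD; apply: lerD.
  apply: le_trans (Re_inner_le _ _) _; rewrite hnorm_rank_one.
  by rewrite ler_wpM2r ?sqr_ge0.
rewrite inner_embed /= /hs_form big_map raddf_sum /=; apply: ler_sum => p _.
rewrite big_seq1 /= rmorph1 mulr1 (le_trans (ler_norm _))// (le_trans (Re_le_cabs _))//.
by rewrite cabsM cabs_real ger0_norm ?normsq_ge0.
Qed.

End hs_quadratic_form.

(** The rank one operators [x x^*] span a dense subspace by construction of the completion, so only
    0 is orthogonal to all of them. *)
Lemma hs_separated (R : realType) (H : hilbertType R) (f : hs H) :
  f != 0 -> exists x, inner f (rank_one x) != 0.
Proof.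
move=> f0; apply: contrapT => h; move/eqP: f0; apply.
apply: inner_ext => g; rewrite inner0l; apply: cabs_eq0; apply/eqP.
rewrite eq_le cabs_ge0 andbT; apply: (@real_small_le _ _ _ (hnorm f)) => e e0; rewrite add0r.
have [l hl] := embed_dense g e0.
have fl : inner f (embed l : hs H) = 0.
  rewrite embed_hs inner_sumr big1// => p _; rewrite innerZr.
  have [->|hp] := eqVneq (inner f (rank_one p.2)) 0; first by rewrite mulr0.
  by case: h; exists p.2.
rewrite -[g](subrK (embed l : hs H)) innerDr fl addr0.
rewrite -(@ler_pXn2r _ 2) ?nnegrE ?cabs_ge0 ?mulr_ge0 ?hnorm_ge0 ?(ltW e0)// cabs_sqr.
rewrite (le_trans (normsq_inner_le _ _))// exprMn ler_wpM2l ?sqr_ge0//.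
by rewrite ler_pXn2r ?nnegrE ?hnorm_ge0 ?(ltW e0).
Qed.

Section invariant_subspace.
Context (R : realType) (H : hilbertType R) (f : hs H).
Hypothesis f0 : f != 0.

Lemma exists_invariant_subspace : exists V : closedSubspace H,
  [/\ exists2 x, cs_set V x & x != 0,
      finite_dimensional (cs_hilbert V) &
      forall u : unitary H, hs_unitary u f = f -> forall x, cs_set V x -> cs_set V (u x)].
Proof.
have [x1 fx1] := hs_separated f0.
(* The hermitian part of [f] may be 0 or negative. With this scalar the form takes at [x1] the value
   [|<f, x1 x1^*>|^2], which is positive. *)
pose f' : hs H := (inner f (rank_one x1))^* *: f; pose q := hs_quadratic f'.
have qE x : q x = complex.Re ((inner f (rank_one x1))^* * inner f (rank_one x)).
  by rewrite /q /hs_quadratic innerZl.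
have q0 : exists x, 0 < q x.
  exists x1; rewrite qE mulrC -normsq_conj/= lt_neqAle normsq_ge0 andbT eq_sym.
  apply: contra_neq fx1 => h; apply: cabs_eq0; by rewrite /cabs h sqrtr0.
have qZ := hs_quadraticZ f'; have qP := hs_quadratic_parallelogram f'.
have qB := hs_quadratic_bounded f'; have qC := @hs_quadratic_compact _ _ f'.
pose V := @ClosedSubspace R H (maximizer q) (maximizer0 qZ qB)
  (maximizer_linear qZ qP qB) (maximizer_closed qZ qP qB q0).
exists V; split.
- exact: (maximizer_neq0 qZ qP qB qC q0).
- have [n [e [oe he hspan]]] := maximizer_finite qZ qP qB qC q0.
  exists n, (fun i => cs_elt (V := V) (he i)) => x.
  exists (fun i => inner (val x) (e i)); apply: val_inj.
  rewrite (raddf_sum (val : cs_hilbert V -> H))/=; exact: hspan (cs_val x).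
- move=> u uf x hx; rewrite /=/maximizer/= /defect unitary_norm (_ : q (u x) = q x)//.
  by rewrite !qE -hs_unitary_rank_one -[in LHS]uf unitary_inner uf.
Qed.

End invariant_subspace.

Lemma exists_invariant_vector (R : realType) (H : hilbertType R) (G : topologicalGroupType)
    (rho : Multiplicative.type G (unitary H)) (xi : H) :
  (forall g (e : R), 0 < e -> \forall h \near g, unitary_dist (rho h) (rho g) < e) ->
  minimally_almost_periodic R G -> amenable R G -> property_T R G -> xi != 0 ->
  exists2 x, x != 0 & forall g, rho g x = x.
Proof.
move=> crho mapG amG TG xi0.
have srho : strongly_continuous rho.
  move=> x; apply/continuous_hnormP => g e e0.
  have n0 : 0 < hnorm x + 1 by rewrite ltr_wpDl ?hnorm_ge0.
  apply: filterS (crho g _ (divr_gt0 e0 n0)) => h; rewrite ltr_pdivlMr// => hgh.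
  apply: le_lt_trans hgh.
  (* A multiple of [x] in the unit ball, where the operator distance is measured; the 1 covers
     [x = 0]. *)
  pose y := ((hnorm x + 1)^-1)%:C *: x.
  have xE : x = (hnorm x + 1)%:C *: y.
    by rewrite /y scalerA -rmorphM/= mulfV ?scale1r// gt_eqF.
  have y1 : hnorm y <= 1.
    rewrite hnormZ ger0_norm ?invr_ge0 ?(ltW n0)// mulrC ler_pdivrMr// mul1r lerDl//.
  have lZ (u : unitary H) c z : u (c *: z) = c *: u z by exact: linearZ_LR.
  have -> : hnorm (rho g x - rho h x) = (hnorm x + 1) * hnorm (rho g y - rho h y).
    by rewrite -[in RHS](ger0_norm (ltW n0)) -hnormZ scalerBr -!lZ -xE.
  by rewrite mulrC ler_wpM2r ?(ltW n0)// Defs.hnormB unitary_dist_ub.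
have [f f1 inv] := TG _ (hs_rep rho) (hs_strongly_continuous srho)
  (hs_almost_invariant crho xi0 amG).
have f0 : f != 0 by apply: contra_eq_neq f1 => ->; rewrite normr0 eq_sym oner_eq0.
have [V [[x Vx x0] fdV invV]] := exists_invariant_subspace f0.
have rV g y : cs_set V y -> cs_set V (rho g y) by apply: invV; exact: inv.
exists x => // g; have := mapG _ (restrict_rep rV) fdV (restrict_strongly_continuous srho) g.
by move=> /(congr1 (fun u : unitary (cs_hilbert V) => val (u (cs_elt Vx)))).
Qed.

(** * The orthogonal complement of the fixed vectors *)

Section fixed_vectors.
Context (R : realType) (H : hilbertType R) (G : groupClosed (unitary H)).

Definition fixed_orthogonal : set H :=
  [set x | forall y, (forall u : unitary H, u \in G -> u y = y) -> inner x y = 0].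

Lemma fixed_orthogonal0 : fixed_orthogonal 0.
Proof. by move=> y _; rewrite inner0l. Qed.

Lemma fixed_orthogonal_linear a x y :
  fixed_orthogonal x -> fixed_orthogonal y -> fixed_orthogonal (a *: x + y).
Proof. by move=> hx hy z hz; rewrite innerDl innerZl hx// hy// mulr0 addr0. Qed.

Lemma fixed_orthogonal_closed x :
  (forall e : R, 0 < e -> exists2 y, fixed_orthogonal y & hnorm (x - y) <= e) ->
  fixed_orthogonal x.
Proof.
move=> h y hy; apply: cabs_eq0; apply/eqP; rewrite eq_le cabs_ge0 andbT.
apply: (@real_small_le _ _ _ (hnorm y)) => e e0; rewrite add0r.
have [z hz xz] := h e e0.
rewrite -(subrK z x) innerDl (hz y hy) addr0.
rewrite -(@ler_pXn2r _ 2) ?nnegrE ?cabs_ge0 ?mulr_ge0 ?hnorm_ge0 ?(ltW e0)// cabs_sqr.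
rewrite (le_trans (normsq_inner_le _ _))// mulrC exprMn ler_wpM2l ?sqr_ge0//.
by rewrite ler_pXn2r ?nnegrE ?hnorm_ge0 ?(ltW e0).
Qed.

Definition fixed_orthogonal_subspace : closedSubspace H :=
  ClosedSubspace fixed_orthogonal0 fixed_orthogonal_linear fixed_orthogonal_closed.

Definition subgroup_rep (g : subgroup G) : unitary H := val g.

HB.instance Definition _ := isMultiplicative.Build (subgroup G) (unitary H) subgroup_rep
  (fun g h => erefl).

Lemma fixed_orthogonal_invariant (g : subgroup G) x :
  fixed_orthogonal x -> fixed_orthogonal (subgroup_rep g x).
Proof.
move=> hx y hy; rewrite -{1}(hy (val g) (valP g)) unitary_inner; exact: hx.
Qed.

(** For a fixed vector [y], [<u x, y> = <u x, u y> = <x, y>]. This supplies nonzero vectors of the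
    complement when [u] is not 1. *)
Lemma fixed_orthogonal_sub (u : unitary H) x : u \in G -> fixed_orthogonal (u x - x).
Proof.
move=> uG y hy; rewrite innerBl -{1}(hy u uG) unitary_inner subrr//.
Qed.

End fixed_vectors.

Theorem corollary1p5 (R : realType) (H : hilbertType R)
  (G : groupClosed (unitary H)) :
  (exists2 u, u \in G & u != 1%g) ->
  minimally_almost_periodic R (subgroup G) ->
  amenable R (subgroup G) ->
  ~ property_T R (subgroup G).
Proof.
move=> [u uG u1] mapG amG TG.
have [z uz] : exists z, u z - z != 0.
  apply: contrapT => h; move/eqP: u1; apply; apply: unitary_eq => z.
  apply/eqP; rewrite -subr_eq0; apply/negP => /negP uz; apply: h; by exists z.
pose W := fixed_orthogonal_subspace G.
pose rho := restrict_rep (V := W) (@fixed_orthogonal_invariant _ _ G).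
have uzW : cs_set W (u z - z) := fixed_orthogonal_sub z uG.
have crho g (e : R) : 0 < e -> \forall h \near g, unitary_dist (rho h) (rho g) < e.
  move=> e0; have cval := @subgroup_val_continuous (unitary H) G g.
  have /cvg_ballP/(_ e e0) := cval; apply: filterS => h; rewrite unitary_ballE /= => gh.
  by rewrite (le_lt_trans (restrict_dist _ _ _))// unitary_dist_sym.
have [|x x0 xfix] :=
  @exists_invariant_vector R (cs_hilbert W) (subgroup G) rho (cs_elt uzW) crho mapG amG TG.
  by apply: contra_neq uz => /(congr1 val).
(* The vector [x] is fixed by G and orthogonal to all fixed vectors, hence to itself. *)
have /eqP := x0; apply; apply: val_inj; apply: hnorm_eq0; apply/eqP; rewrite -sqrf_eq0; apply/eqP.
apply: complexI; rewrite -innerxx; apply: (cs_val x) => v vG.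
by have /(congr1 val) := xfix (exist _ v vG).
Qed.
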